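(* Let $p,q\ge2$ be integers. If $q\ne2$ or $p\ge5$, then the (unique) special point $(\widetilde\beta_{p,q},\widetilde h_{p,q})$ satisfies $\widetilde h_{p,q}>0$, and there exists a strictly decreasing, smooth function $\phi_{p,q}:[0,\widetilde h_{p,q})\to[0,\infty)$ such that $$\mathcal C^1_{p,q}=\left\{(\phi_{p,q}(h),h):h\in[0,\widetilde h_{p,q})\right\}.$$ Further, $\phi_{p,q}(0)=\beta_c(p,q)$ and $\lim_{x\to\widetilde h_{p,q}}\phi_{p,q}(x)=\widetilde\beta_{p,q}$. Otherwise, i.e. if $q=2$ and $p\in\{2,3,4\}$, the set $\mathcal C^1_{p,q}$ is empty.
   Context: $\Theta=(0,\infty)\times[0,\infty)$ is the parameter space. On the set $\mathcal P_q$ of probability vectors in $\mathbb R^q$, $H_{\beta,h}(\boldsymbol t)=\beta\sum_{r=1}^q t_r^p+ht_1-\sum_{r=1}^q t_r\log t_r$ (with $0\log0=0$). For $s\in[0,1]$, $\boldsymbol x_s=\left(\frac{1+(q-1)s}{q},\frac{1-s}{q},\dots,\frac{1-s}{q}\right)$ and $f_{\beta,h}(s)=H_{\beta,h}(\boldsymbol x_s)$. With $\boldsymbol Q_{\boldsymbol v,\beta}(\boldsymbol t)=\sum_{r=1}^q\left(\beta p(p-1)v_r^{p-2}-\frac1{v_r}\right)t_r^2$ and $\mathcal H_q=\{\boldsymbol t\in\mathbb R^q:\sum_r t_r=0\}$: a point $(\beta,h)\in\Theta$ is special if $H_{\beta,h}$ has a unique global maximizer $\boldsymbol m_*$ and $\boldsymbol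 Q_{\boldsymbol m_*,\beta}$ is singular on $\mathcal H_q$ (there is a nonzero $\boldsymbol t\in\mathcal H_q$ with $\boldsymbol Q_{\boldsymbol m_*,\beta}(\boldsymbol t)=0$); there is exactly one special point for each $(p,q)$, denoted $(\widetilde\beta_{p,q},\widetilde h_{p,q})$. A point $(\beta,h)\in\Theta$ is critical if $H_{\beta,h}$ has more than one global maximizer and $\boldsymbol Q_{\boldsymbol m,\beta}$ is negative definite on $\mathcal H_q$ for each global maximizer $\boldsymbol m$; $\mathcal C^1_{p,q}$ is the set of critical points for which $f_{\beta,h}$ has more than one global maximizer on $[0,1]$. $\beta_c(p,q)=\inf\{\beta\ge0:f_{\beta,0}\text{ has a positive global maximizer}\}\in(0,\infty)$. *)

(* Defs.v *)
From HB Require Import structures.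
From mathcomp Require Import all_boot all_order all_algebra.
From mathcomp Require Import all_classical all_reals all_analysis.

Set Implicit Arguments.
Unset Strict Implicit.
Unset Printing Implicit Defensive.

Import Order.TTheory GRing.Theory Num.Theory.
Import numFieldNormedType.Exports.

Local Open Scope classical_set_scope.
Local Open Scope ring_scope.

Section General.
Context {R : realType}.

Definition global_maximizers {T : Type} (F : T -> R) (D : set T) : set T :=
  [set x | D x /\ forall y, D y -> F y <= F x].

Definition unique_element {T : Type} (A : set T) : Prop :=
  exists x, A = [set x].

Definition more_than_one {T : Type} (A : set T) : Prop :=
  exists x y, [/\ A x, A y & x <> y].

(* Smoothness on an arbitrary (e.g. half-open) subset of the line: existence of
   a C^oo extension to an open neighbourhood. On the open set U, existence of
   all iterated derivatives entails their continuity. *)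
Definition smooth_on (D : set R) (f : R -> R) : Prop :=
  exists (U : set R) (g : R -> R),
    [/\ open U, D `<=` U, forall x, D x -> g x = f x &
        forall (n : nat) (x : R), U x -> derivable (derive1n n g) x 1].

End General.

(* The coordinates t_1, ..., t_q of a vector are t 0 r with r : 'I_q, so that
   t_1 is the coordinate with r = 0 :> nat. *)
Section TensorPotts.
Context {R : realType}.
Variables p q : nat.

Definition Theta : set (R * R) := [set x | 0 < x.1 /\ 0 <= x.2].

Definition prob_vectors : set 'rV[R]_q :=
  [set t | (forall r, 0 <= t 0 r) /\ \sum_(r < q) t 0 r = 1].

Definition first_coord (t : 'rV[R]_q) : R :=
  \sum_(r < q | r == 0%N :> nat) t 0 r.

(* 0 log 0 = 0 holds automatically since ln 0 = 0 in the library. *)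
Definition H (beta h : R) (t : 'rV[R]_q) : R :=
  beta * (\sum_(r < q) t 0 r ^+ p) + h * first_coord t
  - \sum_(r < q) t 0 r * ln (t 0 r).

Definition x_vec (s : R) : 'rV[R]_q :=
  \row_(r < q) (if r == 0%N :> nat then (1 + (q%:R - 1) * s) / q%:R
                else (1 - s) / q%:R).

Definition f (beta h s : R) : R := H beta h (x_vec s).

(* Only used at maximizers v of H, whose coordinates are all positive; p >= 2
   throughout, so that the exponent p - 2 is not truncated. *)
Definition Q (v : 'rV[R]_q) (beta : R) (t : 'rV[R]_q) : R :=
  \sum_(r < q)
    (beta * p%:R * (p%:R - 1) * v 0 r ^+ (p - 2) - (v 0 r)^-1) * t 0 r ^+ 2.

Definition Hq : set 'rV[R]_q := [set t | \sum_(r < q) t 0 r = 0].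

Definition singular_on_Hq (B : 'rV[R]_q -> R) : Prop :=
  exists t, [/\ Hq t, t <> 0 & B t = 0].

Definition negative_definite_on_Hq (B : 'rV[R]_q -> R) : Prop :=
  forall t, Hq t -> t <> 0 -> B t < 0.

Definition special (x : R * R) : Prop :=
  [/\ Theta x,
      unique_element (global_maximizers (H x.1 x.2) prob_vectors) &
      forall m, global_maximizers (H x.1 x.2) prob_vectors m ->
        singular_on_Hq (Q m x.1)].

Definition critical (x : R * R) : Prop :=
  [/\ Theta x,
      more_than_one (global_maximizers (H x.1 x.2) prob_vectors) &
      forall m, global_maximizers (H x.1 x.2) prob_vectors m ->
        negative_definite_on_Hq (Q m x.1)].

Definition C1 : set (R * R) :=
  [set x | critical x /\ more_than_one (global_maximizers (f x.1 x.2) `[0, 1]%classic)].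

Definition beta_c : R :=
  inf [set beta | 0 <= beta /\
         exists s, 0 < s /\ global_maximizers (f beta 0) `[0, 1]%classic s].

End TensorPotts.

Arguments special {R} p q x.
Arguments critical {R} p q x.
Arguments C1 {R} p q.
Arguments beta_c {R} p q.

(* Main.v *)
Require Import Defs.
From HB Require Import structures.
From mathcomp Require Import all_boot all_order all_algebra.
From mathcomp Require Import all_classical all_reals all_analysis.
From mathcomp Require Import ring lra zify.

Set Implicit Arguments.
Unset Strict Implicit.
Unset Printing Implicit Defensive.

Import Order.TTheory GRing.Theory Num.Theory.
Import numFieldNormedType.Exports.
Local Open Scope classical_set_scope.
Local Open Scope ring_scope.

(** A maximizer of [H] on the simplex exists by compactness. Moving mass between
two of its coordinates shows that all coordinates are positive and that, apart
from a largest one (the first one if [h > 0]), they are equal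
([maximizer_symmetric]). With [x] the value of that coordinate, [H] becomes
[energy b h x = b * A x + h * x + S x] on [[1/q, 1]], and the quadratic form is
singular, or negative definite, on the zero-sum vectors according to whether
the second derivative of the energy vanishes or is negative
([Q_singular], [Q_negative_definite]). Everything is about this function of one
variable.

Its second derivative is [A2 x * (b - rho x)] with [A2 > 0]. The slope of
[1 / rho] has the sign of an explicit polynomial in the ratio of [x] to the value
of the other coordinates. For all [p, q >= 2] this polynomial changes sign at
most once, from positive to negative ([slope_poly_falls_once]), so that [rho]
decreases up to some [x0] and increases afterwards ([weight_peak]). Here
[x0 > 1/q] exactly when [q <> 2] or [p >= 5]. Two maximizers [u < v] are then
separated by [x0] ([two_maximizers]), which is impossible if [x0 = 1/q]. A
maximizer with vanishing second derivative must be [x0], with [b = rho x0] and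
the value [h_deg] of [h] making [x0] critical: this is the special point. All
other maximizers are nondegenerate, so a point belongs to [C1] if and only if
the energy has two maximizers.

The maximum of the energy is a convex function of [(b, h)], whose subgradient at a
maximizer [x] is [(A x, x)]. Monotonicity of subgradients
([maximizer_monotone]) yields most of the remaining claims: two coexistence points
with distinct [h] have [b] in the reverse order, at a given [h] there is at most one,
[h < h_deg] on the curve, the curve tends to the special point
([coexistence_near_deg]), and at [h = 0] its point is the threshold [beta_c]
([coexistence_threshold]). Existence for each [h] in [[0, h_deg)] is the
intermediate value theorem in [b] for the difference between the maxima of the energy
to the right and to the left of [x0] ([coexist_exists]).

For smoothness, the same inequalities bound the chords of the curve from both
sides, first giving continuity ([coexist_lipschitz]), then continuity of the two
maximizers, and then the derivative [- (v - u) / (A v - A u)] of the curve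
([curve_derive]). Implicit differentiation gives the derivatives of [u] and [v].
All three are rational in quantities of the same regularity as [u], [v] and the
curve, and an induction shows that they are infinitely differentiable
([curve_diffn]). At [h = 0] the maximizer [u] is the end [1/q] of the interval; to have
two-sided derivatives there, the argument runs on a slightly larger interval
[[c, 1]] and for [h] slightly negative ([window_exists]). *)

(** * Calculus of one real variable *)

Section Calculus.
Context {R : realType}.
Implicit Types (f g w : R -> R) (a b x y d e : R).

Lemma is_derive_continuous f x d : is_derive x 1 f d -> {for x, continuous f}.
Proof.
by move=> [fx _]; apply: differentiable_continuous; exact/derivable1_diffP.
Qed.

Lemma is_derive_expr (k : nat) x :
  is_derive x 1 (fun y => y ^+ k) (k%:R * x ^+ k.-1).
Proof.
apply: DeriveDef; first exact: exprn_derivable.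
by rewrite exp_derive /GRing.scale /= mulr1.
Qed.

Lemma pointwise_MVT f f1 a b : a < b ->
  (forall x, a <= x <= b -> {for x, continuous f}) ->
  (forall x, a < x < b -> is_derive x 1 f (f1 x)) ->
  exists2 c, a < c < b & f b - f a = f1 c * (b - a).
Proof.
move=> ab cf df.
have df' x : x \in `]a, b[ -> is_derive x 1 f (f1 x).
  by rewrite in_itv /=; exact: df.
have [|c] := MVT ab df'.
  apply: continuous_in_subspaceT => x; rewrite inE /= in_itv /=; exact: cf.
by rewrite in_itv /= => cab fE; exists c.
Qed.

Lemma derive_gt0_lt f f1 a b : a < b ->
  (forall x, a <= x <= b -> {for x, continuous f}) ->
  (forall x, a < x < b -> is_derive x 1 f (f1 x)) ->
  (forall x, a < x < b -> 0 < f1 x) -> f a < f b.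
Proof.
move=> ab cf df f1_gt0; have [c cab fE] := pointwise_MVT ab cf df.
by rewrite -subr_gt0 fE mulr_gt0 ?f1_gt0 ?subr_gt0.
Qed.

Lemma derive_lt0_gt f f1 a b : a < b ->
  (forall x, a <= x <= b -> {for x, continuous f}) ->
  (forall x, a < x < b -> is_derive x 1 f (f1 x)) ->
  (forall x, a < x < b -> f1 x < 0) -> f b < f a.
Proof.
move=> ab cf df f1_lt0; have [c cab fE] := pointwise_MVT ab cf df.
by rewrite -subr_lt0 fE pmulr_llt0 ?f1_lt0 ?subr_gt0.
Qed.

Lemma derive_eq_zero f f1 a b : a < b -> f a = f b ->
  (forall x, a <= x <= b -> {for x, continuous f}) ->
  (forall x, a < x < b -> is_derive x 1 f (f1 x)) ->
  exists2 c, a < c < b & f1 c = 0.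
Proof.
move=> ab fab cf df; have [c cab fE] := pointwise_MVT ab cf df.
exists c => //; move/eqP: fE; rewrite fab subrr eq_sym mulf_eq0 subr_eq0.
by rewrite (gt_eqF ab) orbF => /eqP.
Qed.

Lemma derive_gt0_local f x d : is_derive x 1 f d -> 0 < d ->
  exists2 e, 0 < e & (forall y, x < y < x + e -> f x < f y) /\
                     (forall y, x - e < y < x -> f y < f x).
Proof.
move=> /is_derive1_caratheodory [h [fE hc hx]] d0.
have : \forall y \near x, 0 < h y.
  by move/cvgr_gt: hc => /(_ 0); apply; rewrite hx.
case=> e /= e0 he; exists e => //; split=> y /andP[xy yx].
  rewrite -subr_gt0 fE mulr_gt0 ?subr_gt0//; apply: he => /=.
  by rewrite /ball_ /= ltr0_norm; lra.
rewrite -subr_lt0 fE pmulr_rlt0 ?subr_lt0//; apply: he => /=.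
by rewrite /ball_ /= gtr0_norm; lra.
Qed.

Lemma derive_lt0_local f x d : is_derive x 1 f d -> d < 0 ->
  exists2 e, 0 < e & (forall y, x < y < x + e -> f y < f x) /\
                     (forall y, x - e < y < x -> f x < f y).
Proof.
move=> df d0; have dN : is_derive x 1 (- f) (- d) by exact: is_deriveN.
have [|e e0 [r l]] := derive_gt0_local dN; first by rewrite oppr_gt0.
by exists e => //; split=> y xy; rewrite -ltrN2; [apply: r|apply: l].
Qed.

Lemma interior_max_derive f x d a b : a < x < b -> is_derive x 1 f d ->
  (forall y, a < y < b -> f y <= f x) -> d = 0.
Proof.
move=> /andP[ax xb] df fmax; case: (ltgtP d 0) => // d0.
- have [e e0 [_ l]] := derive_lt0_local df d0.
  pose m := Num.max a (x - e).
  have mx : m < x by rewrite gt_max ax; lra.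
  have am : a <= m by rewrite le_max lexx.
  have em : x - e <= m by rewrite le_max lexx orbT.
  have h1 : x - e < (m + x) / 2 < x by apply/andP; split; lra.
  have h2 : a < (m + x) / 2 < b by apply/andP; split; lra.
  by have := lt_le_trans (l _ h1) (fmax _ h2); rewrite ltxx.
- have [e e0 [r _]] := derive_gt0_local df d0.
  pose m := Num.min b (x + e).
  have mx : x < m by rewrite lt_min xb; lra.
  have am : m <= b by rewrite ge_min lexx.
  have em : m <= x + e by rewrite ge_min lexx orbT.
  have h1 : x < (m + x) / 2 < x + e by apply/andP; split; lra.
  have h2 : a < (m + x) / 2 < b by apply/andP; split; lra.
  by have := lt_le_trans (r _ h1) (fmax _ h2); rewrite ltxx.
Qed.

(** A positive second derivative at a critical point makes the function
increase strictly to the right of it. *)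
Lemma interior_max_derive2 f f1 x d a b : a < x < b ->
  (forall y, a < y < b -> is_derive y 1 f (f1 y)) -> is_derive x 1 f1 d ->
  (forall y, a < y < b -> f y <= f x) -> d <= 0.
Proof.
move=> xab df df1 fmax; rewrite leNgt; apply/negP => d0.
have f1x := interior_max_derive xab (df _ xab) fmax.
have [e e0 [r _]] := derive_gt0_local df1 d0.
case/andP: (xab) => ax xb; pose m := Num.min b (x + e).
have mx : x < m by rewrite lt_min xb; lra.
have am : m <= b by rewrite ge_min lexx.
have em : m <= x + e by rewrite ge_min lexx orbT.
pose z := (m + x) / 2; have xz : x < z by rewrite /z; lra.
have zm : z < m by rewrite /z; lra.
have : f x < f z.
  apply: (@derive_gt0_lt _ f1) => // y /andP[xy yz].
  - by apply: is_derive_continuous (df _ _); apply/andP; split; lra.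
  - by apply: df; apply/andP; split; lra.
  - by rewrite -f1x; apply: r; apply/andP; split; lra.
have /fmax : a < z < b by apply/andP; split; lra.
by rewrite leNgt => /negP.
Qed.

Lemma max_on_segment f a b : a <= b -> continuous f ->
  exists2 c, a <= c <= b & forall y, a <= y <= b -> f y <= f c.
Proof.
move=> ab cf; have [|c] := EVT_max (f := f) ab.
  exact: continuous_subspaceT.
by rewrite in_itv /= => cab cmax; exists c => // y yab; apply: cmax; rewrite in_itv.
Qed.

(** By compactness, values away from a strict maximizer stay below the maximum
by a definite amount, so a maximizer moves little under a small uniform
perturbation. *)
Lemma strict_max_gap f a b u e : continuous f -> 0 < e ->
  (forall x, a <= x <= b -> x != u -> f x < f u) ->
  exists2 d, 0 < d & forall x, a <= x <= b -> e <= `|x - u| -> f x <= f u - d.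
Proof.
move=> cf e0 fmax.
have half a' b' : a <= a' -> b' <= b -> (forall x, a' <= x <= b' -> x != u) ->
    exists2 d, 0 < d & forall x, a' <= x <= b' -> f x <= f u - d.
  move=> aa bb nu; have [ab|ba] := leP a' b'; last first.
    by exists 1 => // x /andP[? ?]; exfalso; lra.
  have [c cab cmax] := max_on_segment ab cf.
  exists (f u - f c).
    by rewrite subr_gt0 fmax ?nu//; move: cab => /andP[? ?]; apply/andP; split; lra.
  by move=> x /cmax; rewrite subKr.
have [||x /andP[? ?]|dl dl0 Hl] := half a (Num.min b (u - e)) => //.
- by rewrite ge_min lexx.
- have : x <= u - e by apply: le_trans (_ : _ <= Num.min b (u - e)) _; rewrite // ge_min lexx orbT.
  by move=> ?; apply/eqP => ?; lra.
have [||x /andP[? ?]|dr dr0 Hr] := half (Num.max a (u + e)) b => //.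
- by rewrite le_max lexx.
- have : u + e <= x by apply: le_trans (_ : Num.max a (u + e) <= _); rewrite // le_max lexx orbT.
  by move=> ?; apply/eqP => ?; lra.
exists (Num.min dl dr); first by rewrite lt_min dl0.
have ml : Num.min dl dr <= dl by rewrite ge_min lexx.
have mr : Num.min dl dr <= dr by rewrite ge_min lexx orbT.
move=> x /andP[ax xb]; have [xu|ux] := leP x u.
  rewrite ler0_norm ?subr_le0// => ex.
  apply: (le_trans (Hl x _)); last lra.
  by rewrite ax le_min xb; lra.
rewrite gtr0_norm ?subr_gt0// => ex.
apply: (le_trans (Hr x _)); last lra.
by rewrite xb andbT ge_max ax; lra.
Qed.

(** Implicit differentiation: only the continuity of [u] is assumed, its
derivative comes from that of [k \o u]. *)
Lemma is_derive_implicit (k u : R -> R) h d e : d != 0 ->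
  is_derive (u h) 1 k d -> {for h, continuous u} -> is_derive h 1 (k \o u) e ->
  is_derive h 1 u (e / d).
Proof.
move=> d0 /is_derive1_caratheodory[s [sE sc sd]] uc.
move=> /is_derive1_caratheodory[t [tE tc te]].
apply/is_derive1_caratheodory.
pose r z := if z == h then e / d else (u z - u h) / (z - h).
exists r; split; last by rewrite /r eqxx.
  move=> z; rewrite /r; case: eqVneq => [->|zh]; first by rewrite !subrr mulr0.
  by rewrite divfK// subr_eq0.
have suc : s (u z) @[z --> h] --> d.
  by rewrite -sd; apply: (@continuous_comp _ _ _ u s).
have tsc : (t z / s (u z)) @[z --> h] --> e / d.
  by apply: cvgM; [rewrite -te|apply: cvgV].
have rh : r h = e / d by rewrite /r eqxx.
suff: r z @[z --> h] --> e / d by rewrite -rh.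
apply: cvg_trans tsc.
apply: near_eq_cvg; near=> z.
have sz : s (u z) != 0 by near: z; apply: (cvgr_neq0 _ suc).
rewrite /r; case: eqVneq => [->|zh]; first by rewrite te sd.
apply: (mulIf sz); rewrite divfK// mulrAC.
have -> : (u z - u h) * s (u z) = t z * (z - h) by rewrite mulrC -sE -tE.
by rewrite mulfK// subr_eq0.
Unshelve. all: by end_near. Qed.

(** At a zero of [f] the product rule asks only for continuity of the other
factor, which is all that is known of the maximizers before they are shown to
be differentiable. *)
Lemma is_derive_vanishM f w x d : f x = 0 -> is_derive x 1 f d ->
  {for x, continuous w} -> is_derive x 1 (fun z => f z * w z) (d * w x).
Proof.
move=> fx /is_derive1_caratheodory[s [sE sc sd]] wc.
apply/is_derive1_caratheodory; exists (fun z => s z * w z).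
split; last by rewrite sd.
- by move=> z; rewrite fx mul0r subr0 mulrAC -sE fx subr0.
- exact: continuousM.
Qed.

(** Minimum and maximum appear because, for chords of a decreasing function, the
roles of the two bounds are exchanged from one side of [h] to the other. *)
Lemma is_derive_squeeze (g lo hi : R -> R) h d : 
  {for h, continuous lo} -> {for h, continuous hi} -> lo h = d -> hi h = d ->
  (\forall z \near h, z != h ->
     Num.min (lo z) (hi z) <= (g z - g h) / (z - h) <= Num.max (lo z) (hi z)) ->
  is_derive h 1 g d.
Proof.
move=> cl ch lh hh H; apply/is_derive1_caratheodory.
pose r z := if z == h then d else (g z - g h) / (z - h).
exists r; split; last by rewrite /r eqxx.
  move=> z; rewrite /r; case: eqVneq => [->|zh]; first by rewrite !subrr mulr0.
  by rewrite divfK// subr_eq0.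
have rh : r h = d by rewrite /r eqxx.
suff: r z @[z --> h] --> d by rewrite -[in X in _ --> X]rh.
have cmin : Num.min (lo z) (hi z) @[z --> h] --> d.
  by rewrite -[d]minxx -{1}lh -hh; apply: continuous_min.
have cmax : Num.max (lo z) (hi z) @[z --> h] --> d.
  by rewrite -[d]maxxx -{1}lh -hh; apply: continuous_max.
apply: squeeze_cvgr cmin cmax; near=> z.
rewrite /r; case: eqVneq => [->|zh]; first by rewrite lh hh minxx maxxx lexx.
by move: zh; near: z.
Unshelve. all: by end_near. Qed.

End Calculus.

(** * Iterated differentiability on an open set *)

Section Smooth.
Context {R : realType}.
Implicit Types (f g : R -> R) (U : set R) (n : nat).

(** Exhibiting each derivative, rather than iterating the operator [derive1],
lets one bound the class of a function from a formula for its derivative. *)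
Fixpoint diffn n U g : Prop :=
  if n is m.+1 then
    exists2 g', (forall x, U x -> is_derive x 1 g (g' x)) & diffn m U g'
  else True.

Lemma diffnW n U g : diffn n.+1 U g -> diffn n U g.
Proof.
elim: n g => [//|n IH] g [g' dg Cg']; exists g' => //; exact: IH.
Qed.

Lemma eq_diffn n U f g : open U -> (forall x, U x -> f x = g x) ->
  diffn n U f -> diffn n U g.
Proof.
move=> oU fg; case: n => [//|n [f' df Cf']]; exists f' => // x Ux.
apply: near_eq_is_derive (df _ Ux).
by near=> y; apply: fg; near: y; exact: open_nbhs_nbhs.
Unshelve. all: by end_near. Qed.

Lemma diffn_derive1n U g : open U -> (forall n, diffn n U g) ->
  forall n x, U x -> derivable (derive1n n g) x 1.
Proof.
move=> oU Cg n; have {Cg} : diffn n.+1 U g by [].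
elim: n g => [|n IH] g [g' dg Cg'] x Ux.
  by rewrite derive1n0; have [] := dg _ Ux.
rewrite derive1Sn; apply: IH => //; apply: (@eq_diffn n.+1 _ g') => // y Uy.
by rewrite derive1E; have [_ ->] := dg _ Uy.
Qed.

Lemma diffn_cst n U (c : R) : diffn n U (cst c).
Proof.
by elim: n c => [//|n IH] c; exists (cst 0) => // x _; apply: is_derive_cst.
Qed.

Lemma diffnD n U f g : diffn n U f -> diffn n U g ->
  diffn n U (fun x => f x + g x).
Proof.
elim: n f g => [//|n IH] f g [f' df Cf] [g' dg Cg].
exists (fun x => f' x + g' x) => [x Ux|]; last exact: IH.
exact: is_deriveD (df _ Ux) (dg _ Ux).
Qed.

Lemma diffnM n U f g : diffn n U f -> diffn n U g ->
  diffn n U (fun x => f x * g x).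
Proof.
elim: n f g => [//|n IH] f g Cf Cg.
case: (Cf) (Cg) => f' df Cf' [g' dg Cg'].
exists (fun x => f x * g' x + g x * f' x) => [x Ux|].
  exact: is_deriveM (df _ Ux) (dg _ Ux).
by apply: diffnD; apply: IH => //; exact: diffnW.
Qed.

Lemma diffnN n U f : diffn n U f -> diffn n U (fun x => - f x).
Proof.
move=> Cf; have -> : (fun x => - f x) = (fun x => cst (-1) x * f x).
  by apply/funext => x /=; rewrite mulN1r.
by apply: diffnM => //; exact: diffn_cst.
Qed.

Lemma diffnB n U f g : diffn n U f -> diffn n U g ->
  diffn n U (fun x => f x - g x).
Proof. by move=> Cf Cg; apply: diffnD => //; exact: diffnN. Qed.

Lemma diffnX n U f k : diffn n U f -> diffn n U (fun x => f x ^+ k).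
Proof.
move=> Cf; elim: k => [|k IH].
  have -> : (fun x => f x ^+ 0) = cst 1 by apply/funext => x; rewrite expr0.
  exact: diffn_cst.
have -> : (fun x => f x ^+ k.+1) = (fun x => f x * f x ^+ k).
  by apply/funext => x; rewrite exprS.
exact: diffnM.
Qed.

Lemma diffnV n U f : (forall x, U x -> f x != 0) -> diffn n U f ->
  diffn n U (fun x => (f x)^-1).
Proof.
move=> f0; elim: n => [//|n IH] Cf; case: (Cf) => f' df Cf'.
exists (fun x => - ((f x)^-1 * (f x)^-1 * f' x)) => [x Ux|].
  have -> : - ((f x)^-1 * (f x)^-1 * f' x) = - (f x) ^- 2 *: f' x.
    by rewrite -expr2 -exprVn scaleNr.
  exact: is_deriveV (f0 _ Ux) (df _ Ux).
have CV : diffn n U (fun x => (f x)^-1) by apply: IH; exact: diffnW.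
by apply: diffnN; apply: diffnM => //; exact: diffnM.
Qed.

End Smooth.

(** * Energy-entropy competition in one variable *)

Section Competition.
Context {R : realType}.
Variables (A A1 A2 S S1 S2 rho : R -> R) (e x0 : R).
Implicit Types b c d h t u v x y z : R.

(** [b] is the inverse temperature, [h] the external field, [A] the interaction
and [S] the entropy. *)
Definition energy (b h x : R) := b * A x + h * x + S x.
Definition energy1 (b h x : R) := b * A1 x + h + S1 x.
Definition energy2 (b x : R) := b * A2 x + S2 x.

Definition maximizer_from (c b h x : R) :=
  c <= x <= 1 /\ forall y, c <= y <= 1 -> energy b h y <= energy b h x.

(** The maximum is a convex function of [(b, h)] with subgradient [(A x, x)]
at a maximizer [x]; subgradients of a convex function are monotone. *)
Lemma maximizer_monotone c b h x b' h' y :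
  maximizer_from c b h x -> maximizer_from c b' h' y ->
  (b' - b) * (A x - A y) + (h' - h) * (x - y) <= 0.
Proof.
move=> [cx xmax] [cy ymax]; have := xmax _ cy; have := ymax _ cx.
rewrite /energy; lra.
Qed.

(** [rho x] is the value of [b] at which the second derivative at [x] vanishes;
the shape of the energy is governed by [rho] decreasing on [[e, x0]] and
increasing on [[x0, 1)]. The case [e = x0] is that of a monotone [rho], for
which two maximizers never coexist. *)
Record competition : Prop := Competition {
  e_gt0 : 0 < e;
  e_le_x0 : e <= x0;
  x0_lt1 : x0 < 1;
  A_cont : continuous A;
  S_cont : continuous S;
  A_bounded : forall x : R, 0 <= x <= 1 -> `|A x| <= 1;
  A_derive : forall x : R, 0 < x < 1 -> is_derive x 1 A (A1 x);
  A1_derive : forall x : R, 0 < x < 1 -> is_derive x 1 A1 (A2 x);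
  S_derive : forall x : R, 0 < x < 1 -> is_derive x 1 S (S1 x);
  S1_derive : forall x : R, 0 < x < 1 -> is_derive x 1 S1 (S2 x);
  A2_gt0 : forall x : R, 0 < x < 1 -> 0 < A2 x;
  S2E : forall x : R, 0 < x < 1 -> S2 x = - (A2 x * rho x);
  rho_decr : forall x y : R, e <= x -> x < y -> y <= x0 -> rho y < rho x;
  rho_incr : forall x y : R, x0 <= x -> x < y -> y < 1 -> rho x < rho y;
  rho_cont : {for e, continuous rho};
  A1_e : A1 e = 0;
  S1_e : S1 e = 0;
  steep : forall b h, exists2 d : R, d < 1 & forall x : R, d < x < 1 -> energy1 b h x < 0
}.

Hypothesis C : competition.

Let e0 : 0 < e. Proof. by case: C. Qed.
Let ex0 : e <= x0. Proof. by case: C. Qed.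
Let x01 : x0 < 1. Proof. by case: C. Qed.
Let e1 : e < 1. Proof. exact: le_lt_trans ex0 x01. Qed.

Ltac clra := move: e0 ex0 x01 e1 => ? ? ? ?; lra.

Lemma energy_continuous b h : continuous (energy b h).
Proof.
move=> x; apply: cvgD; last exact: (S_cont C).
by apply: cvgD; apply: cvgM; try exact: cvg_cst; [exact: (A_cont C)|exact: cvg_id].
Qed.

Lemma energy_derive b h x : 0 < x < 1 -> is_derive x 1 (energy b h) (energy1 b h x).
Proof.
move=> x01'; have dA := A_derive C x01'; have dS := S_derive C x01'.
have -> : energy b h = (b \*: A + h \*: id) + S.
  by apply/funext => y; rewrite /energy.
by apply: is_derive_eq; rewrite /energy1 /GRing.scale /= mulr1.
Qed.

Lemma energy1_derive b h x : 0 < x < 1 -> is_derive x 1 (energy1 b h) (energy2 b x).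
Proof.
move=> x01'; have dA := A1_derive C x01'; have dS := S1_derive C x01'.
have -> : energy1 b h = (b \*: A1 + cst h) + S1.
  by apply/funext => y; rewrite /energy1.
by apply: is_derive_eq; rewrite /energy2 /GRing.scale /= addr0.
Qed.

Lemma energy2E b x : 0 < x < 1 -> energy2 b x = A2 x * (b - rho x).
Proof. by move=> x01'; rewrite /energy2 (S2E C x01'); ring. Qed.

Lemma energy2_gt0 b x : 0 < x < 1 -> (0 < energy2 b x) = (rho x < b).
Proof.
by move=> x01'; rewrite energy2E// pmulr_rgt0 ?subr_gt0//; exact: (A2_gt0 C).
Qed.

Lemma energy2_lt0 b x : 0 < x < 1 -> (energy2 b x < 0) = (b < rho x).
Proof.
by move=> x01'; rewrite energy2E// pmulr_rlt0 ?subr_lt0//; exact: (A2_gt0 C).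
Qed.

Lemma energy_lt b h x y : 0 < x -> x < y -> y <= 1 ->
  (forall z, x < z < y -> 0 < energy1 b h z) -> energy b h x < energy b h y.
Proof.
move=> x0' xy y1; apply: derive_gt0_lt => // z zxy.
  exact: energy_continuous.
by apply: energy_derive; clra.
Qed.

Lemma energy_gt b h x y : 0 < x -> x < y -> y <= 1 ->
  (forall z, x < z < y -> energy1 b h z < 0) -> energy b h y < energy b h x.
Proof.
move=> x0' xy y1; apply: derive_lt0_gt => // z zxy.
  exact: energy_continuous.
by apply: energy_derive; clra.
Qed.

Lemma energy1_lt b h x y : 0 < x -> x < y -> y < 1 ->
  (forall z, x < z < y -> rho z < b) -> energy1 b h x < energy1 b h y.
Proof.
move=> x0' xy y1 H; apply: (derive_gt0_lt (f1 := energy2 b)) => // z zxy.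
- by apply: is_derive_continuous (energy1_derive _ _ _); clra.
- by apply: energy1_derive; clra.
- by rewrite energy2_gt0; [exact: H|clra].
Qed.

Lemma energy1_gt b h x y : 0 < x -> x < y -> y < 1 ->
  (forall z, x < z < y -> b < rho z) -> energy1 b h y < energy1 b h x.
Proof.
move=> x0' xy y1 H; apply: (derive_lt0_gt (f1 := energy2 b)) => // z zxy.
- by apply: is_derive_continuous (energy1_derive _ _ _); clra.
- by apply: energy1_derive; clra.
- by rewrite energy2_lt0; [exact: H|clra].
Qed.

Lemma A1_gt0 x : e < x < 1 -> 0 < A1 x.
Proof.
move=> /andP[ex x1]; rewrite -(A1_e C); apply: (derive_gt0_lt (f1 := A2)) => // z zx.
- by apply: is_derive_continuous (A1_derive C _); clra.
- by apply: (A1_derive C); clra.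
- by apply: (A2_gt0 C); clra.
Qed.

Lemma A1_lt0 x : 0 < x < e -> A1 x < 0.
Proof.
move=> /andP[ex x1]; rewrite -(A1_e C); apply: (derive_gt0_lt (f1 := A2)) => // z zx.
- by apply: is_derive_continuous (A1_derive C _); clra.
- by apply: (A1_derive C); clra.
- by apply: (A2_gt0 C); clra.
Qed.

Lemma A_lt x y : e <= x -> x < y -> y <= 1 -> A x < A y.
Proof.
move=> ex xy y1; apply: (derive_gt0_lt (f1 := A1)) => // z zxy.
- exact: (A_cont C).
- by apply: (A_derive C); clra.
- by apply: A1_gt0; clra.
Qed.

(** ** Maximizers *)

Lemma maximizer_lt1 c b h x : 0 < c -> c < 1 -> maximizer_from c b h x -> x < 1.
Proof.
move=> c0 c1 [/andP[cx x1] xmax]; rewrite lt_neqAle x1 andbT; apply/eqP => xE.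
have [d d1 dlt0] := steep C b h; pose m := Num.max c d.
have cm : c <= m by rewrite le_max lexx.
have dm : d <= m by rewrite le_max lexx orbT.
have m1 : m < 1 by rewrite gt_max c1.
have : energy b h 1 < energy b h m.
  by apply: energy_gt => // [|z zm1]; [clra|apply: dlt0; clra].
by rewrite ltNge -xE xmax//; clra.
Qed.

Lemma maximizer_critical c b h x : 0 < c -> c < x ->
  maximizer_from c b h x -> energy1 b h x = 0 /\ b <= rho x.
Proof.
move=> c0 cx xm; case: (xm) => /andP[cx' x1'] xmax.
have x1 : x < 1 by apply: (maximizer_lt1 c0 _ xm); clra.
have cx1 : c < x < 1 by rewrite cx.
have ymax y : c < y < 1 -> energy b h y <= energy b h x by move=> ?; apply: xmax; clra.
split.
  by apply: interior_max_derive cx1 (energy_derive _ _ _) ymax; clra.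
have : energy2 b x <= 0.
  apply: (interior_max_derive2 cx1 _ _ ymax) => [y ?|]; first by apply: energy_derive; clra.
  by apply: energy1_derive; clra.
by rewrite leNgt energy2_gt0 -?leNgt//; clra.
Qed.

(** The left end [e] is the zero-field critical point: there the derivative is
[h], which a maximum at an end of the interval forces to be nonpositive. *)
Lemma maximizer_from_e_critical b h x : 0 <= h ->
  maximizer_from e b h x -> energy1 b h x = 0.
Proof.
move=> h0 xm; case: (xm) => /andP[]; rewrite le_eqVlt => /predU1P[ex|ex] x1 xmax.
  have E1 : energy1 b h x = h by rewrite -ex /energy1 (A1_e C) (S1_e C); ring.
  rewrite E1; apply/eqP; rewrite eq_le h0 andbT leNgt; apply/negP => h_gt0.
  have x01' : 0 < x < 1 by have := maximizer_lt1 e0 e1 xm; clra.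
  have [|d d0 [r _]] := derive_gt0_local (energy_derive b h x01').
    by rewrite E1.
  pose m := Num.min (x + d) 1.
  have mx : m <= x + d by rewrite ge_min lexx.
  have m1 : m <= 1 by rewrite ge_min lexx orbT.
  have xm' : x < m by rewrite lt_min; clra.
  have /r : x < (x + m) / 2 < x + d by clra.
  by rewrite ltNge xmax//; clra.
by have [] := maximizer_critical e0 ex xm.
Qed.

(** Moving from a critical point of nonnegative curvature towards [x0], the
curvature is positive all along, so the energy increases up to [x0]. *)
Lemma energy_lt_x0_left b h u : e <= u -> u < x0 -> energy1 b h u = 0 ->
  rho u <= b -> energy b h u < energy b h x0.
Proof.
move=> eu ux E1 rb; apply: energy_lt => //; [clra..|] => z /andP[uz zx].
rewrite -E1; apply: energy1_lt => //; [clra..|] => t /andP[ut tz].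
by apply: lt_le_trans rb; apply: (rho_decr C); clra.
Qed.

Lemma energy_lt_x0_right b h v : x0 < v -> v < 1 -> energy1 b h v = 0 ->
  rho v <= b -> energy b h v < energy b h x0.
Proof.
move=> xv v1 E1 rb; apply: energy_gt => //; [clra..|] => z /andP[xz zv].
rewrite -E1; apply: energy1_lt => //; [clra..|] => t /andP[zt tv].
by apply: lt_le_trans rb; apply: (rho_incr C); clra.
Qed.

(** Away from [x0] a vanishing second derivative would let [x0] do better, so
only a maximizer at [x0] can be degenerate. *)
Lemma maximizer_nondegenerate b h x : 0 <= h ->
  maximizer_from e b h x -> x != x0 -> b < rho x.
Proof.
move=> h0 xm xx; have E1 := maximizer_from_e_critical h0 xm.
have x1 := maximizer_lt1 e0 e1 xm; case: xm => /andP[ex _] xmax.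
rewrite ltNge; apply/negP => rb.
have : energy b h x0 <= energy b h x by apply: xmax; clra.
rewrite leNgt => /negP; apply; case: (ltgtP x x0) xx => // xx _.
  exact: energy_lt_x0_left.
exact: energy_lt_x0_right.
Qed.

Lemma rho_x0_lt x : e <= x < 1 -> x != x0 -> rho x0 < rho x.
Proof.
move=> /andP[ex x1]; case: (ltgtP x x0) => // xx _.
  by apply: (rho_decr C).
by apply: (rho_incr C).
Qed.

(** At [b = rho x0] the curvature is negative except at [x0]: the energy is
strictly concave, with a flat point of the derivative. *)
Lemma energy1_decr_x0 h x y : e <= x -> x < y -> y < 1 ->
  energy1 (rho x0) h y < energy1 (rho x0) h x.
Proof.
move=> ex xy y1.
have side a b : e <= a -> a < b -> b < 1 -> b <= x0 \/ x0 <= a ->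
    energy1 (rho x0) h b < energy1 (rho x0) h a.
  move=> ea ab b1 H; apply: energy1_gt => // [|z zab]; first clra.
  by apply: rho_x0_lt; [clra|apply/eqP => zx; case: H => ?; clra].
have [yx|xy0] := leP y x0; first by apply: side => //; left.
have [xx|x0x] := leP x0 x; first by apply: side => //; right.
by apply: (@lt_trans _ _ (energy1 (rho x0) h x0)); apply: side => //; [right|left].
Qed.

(** Two maximizers are zeros of the derivative; between them the curvature
vanishes, and on the wrong side of [x0] the monotonicity of [rho] makes that
zero beat one of them. *)
Lemma two_maximizers b h u v : 0 <= h -> u < v ->
  maximizer_from e b h u -> maximizer_from e b h v ->
  [/\ u < x0, x0 < v & rho x0 < b].
Proof.
move=> h0 uv um vm.
have Eu := maximizer_from_e_critical h0 um.
have Ev := maximizer_from_e_critical h0 vm.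
have v1 := maximizer_lt1 e0 e1 vm.
case: um vm => /andP[eu _] umax [/andP[ev _] vmax].
have [x xuv E2] : exists2 x, u < x < v & energy2 b x = 0.
  apply: (@derive_eq_zero _ (energy1 b h)) => //; first by rewrite Eu Ev.
    by move=> y yuv; apply: is_derive_continuous (energy1_derive _ _ _); clra.
  by move=> y yuv; apply: energy1_derive; clra.
have bE : b = rho x.
  have x01' : 0 < x < 1 by clra.
  move/eqP: E2; rewrite energy2E// mulf_eq0 subr_eq0 => /orP[|/eqP//].
  by rewrite (gt_eqF (A2_gt0 C x01')).
case/andP: xuv => ux xv.
have ux0 : u < x0.
  rewrite ltNge; apply/negP => x0u; have : energy b h x <= energy b h u by apply: umax; clra.
  rewrite leNgt => /negP; apply; apply: energy_lt => //; [clra..|] => z /andP[uz zx].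
  rewrite -Eu; apply: energy1_lt => //; [clra..|] => t /andP[ut tz].
  by rewrite bE; apply: (rho_incr C); clra.
have x0v : x0 < v.
  rewrite ltNge; apply/negP => vx0; have : energy b h x <= energy b h v by apply: vmax; clra.
  rewrite leNgt => /negP; apply; apply: energy_gt => //; [clra..|] => z /andP[uz zx].
  rewrite -Ev; apply: energy1_lt => //; [clra..|] => t /andP[ut tz].
  by rewrite bE; apply: (rho_decr C); clra.
split=> //; have [xE|xx0] := eqVneq x x0; last by rewrite bE; apply: rho_x0_lt => //; clra.
have := @energy1_decr_x0 h u v eu uv v1.
by rewrite -xE -bE Eu Ev ltxx.
Qed.

(** ** The degenerate point *)

(** The field for which the flat point [x0] is also critical. *)
Definition h_deg := - (rho x0 * A1 x0 + S1 x0).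

Lemma energy1_deg : energy1 (rho x0) h_deg x0 = 0.
Proof. by rewrite /energy1 /h_deg; ring. Qed.

Lemma h_deg_gt0 : e < x0 -> 0 < h_deg.
Proof.
move=> ex; have := @energy1_decr_x0 h_deg e x0 (lexx _) ex x01.
by rewrite energy1_deg /energy1 (A1_e C) (S1_e C) mulr0 add0r addr0.
Qed.

Lemma deg_strict_maximizer y : e <= y <= 1 -> y != x0 ->
  energy (rho x0) h_deg y < energy (rho x0) h_deg x0.
Proof.
move=> /andP[ey y1]; case: (ltgtP y x0) => // yx _.
  apply: energy_lt => //; [clra..|] => z zyx; rewrite -energy1_deg.
  by apply: energy1_decr_x0; clra.
apply: energy_gt => //; [clra..|] => z zyx; rewrite -energy1_deg.
by apply: energy1_decr_x0; clra.
Qed.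

Lemma deg_maximizer : maximizer_from e (rho x0) h_deg x0.
Proof.
split=> [|y ey]; first clra.
by have [->//|yx] := eqVneq y x0; apply/ltW/deg_strict_maximizer.
Qed.

Lemma degenerate_maximizer_unique b h x : 0 <= h ->
  maximizer_from e b h x -> energy2 b x = 0 -> [/\ x = x0, b = rho x0 & h = h_deg].
Proof.
move=> h0 xm E2; have E1 := maximizer_from_e_critical h0 xm.
have x1 := maximizer_lt1 e0 e1 xm; case: (xm) => /andP[ex _] _.
have x01' : 0 < x < 1 by clra.
have xE : x = x0.
  apply/eqP/negPn/negP => /(maximizer_nondegenerate h0 xm).
  by rewrite -(energy2_lt0 b x01') E2 ltxx.
have bE : b = rho x0.
  move/eqP: E2; rewrite energy2E// mulf_eq0 subr_eq0 (gt_eqF (A2_gt0 C x01')) /=.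
  by move/eqP; rewrite xE.
split=> //; move: E1; rewrite xE bE /energy1 /h_deg; clra.
Qed.

End Competition.

(** * The coexistence curve *)

Section Coexistence.
Context {R : realType}.
Variables (A A1 A2 S S1 S2 rho : R -> R) (e x0 : R).
Implicit Types b c d h t u v x y z : R.

Hypothesis C : competition A A1 A2 S S1 S2 rho e x0.
Hypothesis ex : e < x0.

Local Notation F := (energy A S).
Local Notation F1 := (energy1 A1 S1).
Local Notation maximizer_from := (maximizer_from A S).
Local Notation bt := (rho x0).
Local Notation ht := (h_deg A1 S1 rho x0).

Let e0 : 0 < e. Proof. by case: C. Qed.
Let x01 : x0 < 1. Proof. by case: C. Qed.

Ltac clra := move: e0 ex x01 => ? ? ?; lra.

Lemma rho_e_gt : bt < rho e.
Proof. by apply: (rho_decr C). Qed.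

(** Since [A] and the identity are bounded by [1], the energy is Lipschitz in the
parameters, uniformly in [x]; this replaces all compactness in [(b, h)]. *)
Lemma energy_perturb b h b' h' x : 0 <= x <= 1 ->
  `|F b h x - F b' h' x| <= `|b - b'| + `|h - h'|.
Proof.
move=> /[dup] /(A_bounded C) Ax x01'.
have -> : F b h x - F b' h' x = (b - b') * A x + (h - h') * x.
  by rewrite /energy; ring.
apply: le_trans (ler_normD _ _) _; rewrite !normrM.
apply: lerD; rewrite ler_piMr//.
by rewrite ger0_norm; lra.
Qed.

(** At [h = 0] the left maximizer is [e] itself, which leaves [[e, 1]] as soon as
[h < 0]. A smooth extension of the curve across [h = 0] thus calls for an
interval starting at some [c < e]. The conditions say that below the
inverse temperature [b1] the energy is concave on [[c, e]] and increasing at [c],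
that [A] stays below [A x0] there, so that it jumps upwards between the two
maximizers, and that at [b1] the part right of [x0], represented by [x1], wins. *)
Record window (c eps b1 x1 : R) : Prop := Window {
  c_gt0 : 0 < c;
  c_lt_e : c < e;
  eps_gt0 : 0 < eps;
  b1_gt : bt < b1;
  x1_gt : x0 < x1;
  x1_le1 : x1 <= 1;
  rho_left : forall x : R, c <= x <= e -> b1 < rho x;
  A_left : forall x : R, c <= x <= e -> A x < A x0;
  right_wins : forall h x : R, - eps < h -> c <= x <= x0 -> F b1 h x < F b1 h x1;
  F1_left : forall b h : R, b <= b1 -> - eps < h -> 0 < F1 b h c
}.

(** At [b = rho e], [h = 0] the energy increases on all of [[e, x0]] and beyond, so
the right part wins strictly; [b1] is taken slightly below [rho e], and the
strict inequalities survive for [x] near [e] and [h] near [0]. *)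
Lemma window_exists : exists c eps b1 x1, window c eps b1 x1.
Proof.
pose bs := rho e.
have F1e b : F1 b 0 e = 0 by rewrite /energy1 (A1_e C) (S1_e C); ring.
have F1pos x : e < x -> x <= x0 -> 0 < F1 bs 0 x.
  move=> exx xx; rewrite -[X in X < _](F1e bs); apply: (energy1_lt C) => //; [clra..|].
  by move=> z zx; apply: (rho_decr C); clra.
have Fle x : e <= x -> x <= x0 -> F bs 0 x <= F bs 0 x0.
  move=> exx; rewrite le_eqVlt => /predU1P[->//|xx]; apply/ltW.
  by apply: (energy_lt C) => // [| |z zx]; [clra|clra|apply: F1pos; clra].
have x01' : 0 < x0 < 1 by clra.
have [d d0 [dr _]] := derive_gt0_local (energy_derive C bs 0 x01') (F1pos _ ex (lexx _)).
pose m := Num.min (x0 + d) 1.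
have md : m <= x0 + d by rewrite ge_min lexx.
have m1 : m <= 1 by rewrite ge_min lexx orbT.
have xm : x0 < m by rewrite lt_min; clra.
pose x1 := (x0 + m) / 2.
have xx1 : x0 < x1 by rewrite /x1; clra.
have x1m : x1 < m by rewrite /x1; clra.
have dlt : F bs 0 x0 < F bs 0 x1 by apply: dr; clra.
(* five errors of size at most [dl] have to fit into the gap *)
pose dl := (F bs 0 x1 - F bs 0 x0) / 8.
have dl0 : 0 < dl by rewrite /dl; clra.
have bsbt := rho_e_gt; rewrite -/bs in bsbt.
pose b1 := bs - Num.min dl ((bs - bt) / 2).
have min1 : Num.min dl ((bs - bt) / 2) <= dl by rewrite ge_min lexx.
have min2 : Num.min dl ((bs - bt) / 2) <= (bs - bt) / 2 by rewrite ge_min lexx orbT.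
have min0 : 0 < Num.min dl ((bs - bt) / 2) by rewrite lt_min dl0 /=; clra.
have b1s : b1 < bs by rewrite /b1; clra.
have b1t : bt < b1 by rewrite /b1; clra.
have : \forall x \near e, [/\ b1 < rho x, A x < A x0 & F bs 0 x < F bs 0 e + dl].
  near=> x; split; near: x.
  - by apply: (cvgr_gt _ (rho_cont C)).
  - apply: (cvgr_lt (A e)); first exact: (A_cont C).
    by apply: (A_lt C) => //; clra.
  - by apply: (cvgr_lt (F bs 0 e)); [exact: (energy_continuous C)|clra].
case=> r /= r0 Hr.
pose c := e - Num.min r e / 2.
have mr : Num.min r e <= r by rewrite ge_min lexx.
have me : Num.min r e <= e by rewrite ge_min lexx orbT.
have mr0 : 0 < Num.min r e by rewrite lt_min r0 /=; clra.
have c0 : 0 < c by rewrite /c; clra.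
have ce : c < e by rewrite /c; clra.
have {}Hr x : c <= x <= e -> [/\ b1 < rho x, A x < A x0 & F bs 0 x < F bs 0 e + dl].
  move=> cx; apply: Hr => /=; rewrite /ball_ /= ger0_norm; rewrite /c in cx; clra.
have F1c : 0 < F1 b1 0 c.
  rewrite -[X in X < _](F1e b1); apply: (energy1_gt C) => //; [clra..|].
  by move=> z zc; have [] := Hr z; first clra.
pose eps := Num.min dl (F1 b1 0 c).
have eps1 : eps <= dl by rewrite ge_min lexx.
have eps2 : eps <= F1 b1 0 c by rewrite ge_min lexx orbT.
have eps0 : 0 < eps by rewrite lt_min dl0.
have Fx0 x : c <= x <= x0 -> F bs 0 x <= F bs 0 x0 + dl.
  move=> cx; have [xe|xe] := leP x e; last by have := Fle x; clra.
  have [|_ _] := Hr x; first clra.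
  by have := Fle e; clra.
have wins h x : - eps < h -> h <= 0 -> c <= x <= x0 -> F b1 h x < F b1 h x1.
  move=> h1 h2 cx; have FxE := Fx0 x cx.
  have B : bs - b1 <= dl by rewrite /b1; clra.
  have D : F bs 0 x1 = F bs 0 x0 + 8 * dl by rewrite /dl; field.
  have P y : 0 <= y <= 1 -> - (dl + dl) <= F b1 h y - F bs 0 y <= dl + dl.
    move=> /(energy_perturb b1 h bs 0) P; rewrite -ler_norml.
    apply: (le_trans P); apply: lerD; first by rewrite ler0_norm; clra.
    by rewrite ler0_norm; clra.
  have := P x; have := P x1; clra.
exists c, eps, b1, x1; split=> //.
- clra.
- by move=> x /Hr[].
- by move=> x /Hr[].
- move=> h x h1 cx; have [h0|h0] := leP h 0; first exact: wins.
  have := wins 0 x; rewrite /energy => /(_ _ _ cx) W.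
  have {W} : b1 * A x + 0 * x + S x < b1 * A x1 + 0 * x1 + S x1 by apply: W; clra.
  have : h * x < h * x1 by rewrite ltr_pM2l//; clra.
  clra.
- move=> b h bb hh; have A1c : A1 c < 0 by apply: (A1_lt0 C); clra.
  have : 0 <= (b - b1) * A1 c by apply: mulr_le0; clra.
  rewrite /energy1 in eps2 *; clra.
Unshelve. all: by end_near. Qed.

End Coexistence.

Section Curve.
Context {R : realType}.
Variables (A A1 A2 S S1 S2 rho : R -> R) (e x0 : R).
Implicit Types b c d h t u v x y z : R.

Hypothesis C : competition A A1 A2 S S1 S2 rho e x0.
Hypothesis ex : e < x0.

Local Notation F := (energy A S).
Local Notation F1 := (energy1 A1 S1).
Local Notation maximizer_from := (maximizer_from A S).
Local Notation bt := (rho x0).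
Local Notation ht := (h_deg A1 S1 rho x0).

Variables (c eps b1 x1 : R).
Hypothesis W : window A A1 S S1 rho e x0 c eps b1 x1.

Let e0 : 0 < e. Proof. by case: C. Qed.
Let x01 : x0 < 1. Proof. by case: C. Qed.
Let c0 : 0 < c. Proof. by case: W. Qed.
Let ce : c < e. Proof. by case: W. Qed.

Ltac clra := move: e0 ex x01 c0 ce => ? ? ? ? ?; lra.

Definition max_value (l r b h : R) : R :=
  F b h (xget 0 [set x | l <= x <= r /\ forall y, l <= y <= r -> F b h y <= F b h x]).

Lemma max_valueP l r b h : l <= r -> exists x,
  [/\ l <= x <= r, max_value l r b h = F b h x &
      forall y, l <= y <= r -> F b h y <= max_value l r b h].
Proof.
move=> lr; have [x xlr xmax] := max_on_segment lr (@energy_continuous _ _ _ _ _ _ _ _ _ _ C b h).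
have [zlr zmax] := xgetPex 0 (ex_intro
  [set x | l <= x <= r /\ forall y, l <= y <= r -> F b h y <= F b h x]
  x (conj xlr xmax)).
by eexists; split; [exact: zlr|reflexivity|exact: zmax].
Qed.

(** The Lipschitz bound on the energy passes to its maximum over a segment. *)
Lemma max_value_lipschitz l r b b' h : 0 <= l -> l <= r -> r <= 1 ->
  `|max_value l r b h - max_value l r b' h| <= `|b - b'|.
Proof.
move=> l0 lr r1.
have half a a' : max_value l r a h - max_value l r a' h <= `|a - a'|.
  have [x [xlr -> _]] := max_valueP a h lr; have [_ [_ _ H]] := max_valueP a' h lr.
  have x01' : 0 <= x <= 1 by lra.
  have := energy_perturb C a h a' h x01'; rewrite subrr normr0 addr0.
  by have := H _ xlr; have := ler_norm (F a h x - F a' h x); lra.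
by rewrite ler_norml; have := half b b'; have := half b' b; rewrite distrC; lra.
Qed.

(** Coexistence on the larger interval [[c, 1]]: for [h >= 0] the left maximizer
lies in [[e, 1]], and for [h < 0] this continues the curve. *)
Definition coexist h b u v :=
  [/\ bt < b < b1, c < u < x0, x0 < v < 1,
      maximizer_from c b h u & maximizer_from c b h v].

(** For a field below [h_deg] the concave energy at [b = rho x0] is already
decreasing at [x0]: the left part wins. *)
Lemma max_value_gap_deg h : h < ht -> max_value x0 1 bt h < max_value c x0 bt h.
Proof.
move=> hh.
have Fx : F1 bt h x0 < 0.
  by rewrite -[X in _ < X](@energy1_deg _ A1 S1 rho x0) /energy1; clra.
have x01' : 0 < x0 < 1 by clra.
have [d d0 [_ dl]] := derive_lt0_local (energy_derive C bt h x01') Fx.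
have [|y [yx -> _]] := @max_valueP x0 1 bt h; first clra.
have [|_ [_ _ H]] := @max_valueP c x0 bt h; first clra.
apply: (@le_lt_trans _ _ (F bt h x0)).
  case/andP: yx; rewrite le_eqVlt => /predU1P[<-//|xy y1]; apply/ltW.
  apply: (energy_gt C) => // [|z zxy]; first clra.
  by apply: lt_trans Fx; apply: (energy1_decr_x0 C); clra.
pose m := Num.max c (x0 - d).
have mc : c <= m by rewrite le_max lexx.
have md : x0 - d <= m by rewrite le_max lexx orbT.
have mx : m < x0 by rewrite gt_max; clra.
apply: (@lt_le_trans _ _ (F bt h ((m + x0) / 2))); first by apply: dl; clra.
by apply: H; clra.
Qed.

Lemma max_value_gap_b1 h : - eps < h -> max_value c x0 b1 h < max_value x0 1 b1 h.
Proof.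
move=> hh; have [|y [yx -> _]] := @max_valueP c x0 b1 h; first clra.
have [|_ [_ _ H]] := @max_valueP x0 1 b1 h; first clra.
apply: lt_le_trans (right_wins W hh yx) (H _ _).
by have := x1_gt W; have := x1_le1 W; lra.
Qed.

(** Between [b = rho x0], where the left part wins, and [b = b1], where the right
part does, the intermediate value theorem gives a tie. The separating point
[x0] is not a maximizer since the curvature is positive there for
[b > rho x0], so the tie is between two points. *)
Lemma coexist_exists h : - eps < h < ht -> exists b u v, coexist h b u v.
Proof.
move=> /andP[h1 h2].
pose g b := max_value x0 1 b h - max_value c x0 b h.
have gc : continuous g.
  move=> b; apply/cvgrPdist_lt => k k0; near=> b'.
  have L1 := @max_value_lipschitz x0 1 b b' h; have L2 := @max_value_lipschitz c x0 b b' h.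
  have bb : `|b - b'| < k / 2 by near: b'; apply: cvgr_dist_lt => //; lra.
  have -> : g b - g b' = (max_value x0 1 b h - max_value x0 1 b' h)
     - (max_value c x0 b h - max_value c x0 b' h) by rewrite /g; ring.
  apply: le_lt_trans (ler_normB _ _) _.
  have {}L1 : `|max_value x0 1 b h - max_value x0 1 b' h| <= `|b - b'| by apply: L1; clra.
  have {}L2 : `|max_value c x0 b h - max_value c x0 b' h| <= `|b - b'| by apply: L2; clra.
  lra.
have g1 : g bt < 0 by rewrite /g subr_lt0; exact: max_value_gap_deg.
have g2 : 0 < g b1 by rewrite /g subr_gt0; exact: max_value_gap_b1.
have bb := b1_gt W.
have [||b] := @IVT R g bt b1 0 (ltW bb).
- exact: continuous_subspaceT.
- by rewrite ge_min le_max (ltW g1) (ltW g2) orbT.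
rewrite in_itv /= => /andP[bt1 bt2] gb.
have {}bt1 : bt < b.
  by rewrite lt_neqAle bt1 andbT; apply: contraTneq g1 => ->; rewrite gb ltxx.
have {}bt2 : b < b1.
  by rewrite lt_neqAle bt2 andbT; apply: contraTneq g2 => <-; rewrite gb ltxx.
have [|u [ux uE umax]] := @max_valueP c x0 b h; first clra.
have [|v [vx vE vmax]] := @max_valueP x0 1 b h; first clra.
have uvE : F b h u = F b h v by rewrite -uE -vE; move: gb; rewrite /g; lra.
have um : maximizer_from c b h u.
  split=> [|y yc]; first clra.
  by have [yx|xy] := leP y x0; [rewrite -uE umax//|rewrite uvE -vE vmax//]; clra.
have vm : maximizer_from c b h v.
  by split=> [|y /(um.2)]; [clra|rewrite uvE].
have xnm : ~ maximizer_from c b h x0.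
  move=> /(maximizer_critical C c0)[]; first clra.
  by move=> _; rewrite leNgt bt1.
have v1 : v < 1 by apply: (maximizer_lt1 C c0 _ vm); clra.
exists b, u, v; split=> //; first by rewrite bt1.
- have ux0 : u < x0.
    rewrite lt_neqAle; case/andP: ux => _ ->; rewrite andbT.
    by apply/eqP => uE'; apply: xnm; rewrite -uE'.
  rewrite ux0 andbT lt_neqAle; case/andP: (ux) => -> _; rewrite andbT.
  apply/eqP => cu; have := F1_left W (ltW bt2) h1; rewrite cu => Fu.
  have u01 : 0 < u < 1 by clra.
  have [d d0 [dr _]] := derive_gt0_local (energy_derive C b h u01) Fu.
  pose m := Num.min (u + d) 1.
  have md : m <= u + d by rewrite ge_min lexx.
  have m1 : m <= 1 by rewrite ge_min lexx orbT.
  have mu : u < m by rewrite lt_min; clra.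
  have /dr : u < (u + m) / 2 < u + d by lra.
  by rewrite ltNge um.2//; clra.
- rewrite v1 andbT lt_neqAle; case/andP: (vx) => -> _; rewrite andbT.
  by apply/eqP => vE'; apply: xnm; rewrite vE'.
Unshelve. all: by end_near. Qed.

(** ** Properties of a coexistence point *)

Section Point.
Variables (h b u v : R).
Hypothesis P : coexist h b u v.

Let bb : bt < b < b1. Proof. by case: P. Qed.
Let cux : c < u < x0. Proof. by case: P. Qed.
Let xv1 : x0 < v < 1. Proof. by case: P. Qed.
Let um : maximizer_from c b h u. Proof. by case: P. Qed.
Let vm : maximizer_from c b h v. Proof. by case: P. Qed.

Ltac plra := move: bb cux xv1 => ? ? ?; clra.

Lemma coexist_critical : F1 b h u = 0 /\ F1 b h v = 0.
Proof.
have [] := @maximizer_critical _ _ _ _ _ _ _ _ _ _ C c b h u c0; [plra|done|].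
by have [] := @maximizer_critical _ _ _ _ _ _ _ _ _ _ C c b h v c0; [plra|done|].
Qed.

Lemma coexist_curvature : b < rho u /\ b < rho v.
Proof.
have [Fu Fv] := coexist_critical; split; rewrite ltNge; apply/negP => rb.
  have [ue|eu] := leP u e; first by have := rho_left W (x := u); plra.
  have ux : u < x0 by plra.
  by have := energy_lt_x0_left C (ltW eu) ux Fu rb; rewrite ltNge um.2//; plra.
have xv : x0 < v by plra.
have v1 : v < 1 by plra.
by have := energy_lt_x0_right C xv v1 Fv rb; rewrite ltNge vm.2//; plra.
Qed.

(** To the left of a maximizer [z <= x0] the energy is strictly concave, because
[rho] exceeds [b1] on [[c, e]] and decreases from there to [z]. Hence there cannot
be another critical point before [z]. *)
Lemma coexist_left_unique x : c <= x <= x0 -> x != u -> F b h x < F b h u.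
Proof.
move=> cx xu; rewrite lt_neqAle um.2 ?andbT; last plra.
apply/eqP => xE.
have xm : maximizer_from c b h x by split=> [|y /um.2]; [plra|rewrite xE].
have main y z : y < z -> c < z <= x0 -> c <= y -> maximizer_from c b h z ->
    F1 b h z = 0 -> 0 < F1 b h y.
  move=> yz czx cy zm Fz; rewrite -[X in X < _]Fz.
  have [_ rz] := maximizer_critical C c0 (andP czx).1 zm.
  apply: (energy1_gt C) => //; [plra..|] => t tyz.
  have [te|et] := leP t e; first by have := rho_left W (x := t); plra.
  by apply: le_lt_trans rz _; apply: (rho_decr C); plra.
have [Fu _] := coexist_critical.
case: (ltgtP x u) xu => // xu _.
  have : 0 < F1 b h x by apply: (main x u) => //; plra.
  suff -> : F1 b h x = 0 by rewrite ltxx.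
  have [cx'|xc] := ltP c x; first by have [] := maximizer_critical C c0 cx' xm.
  have xc' : x = c by plra.
  have h1 : 0 < F1 b h x by apply: (main x u) => //; plra.
  have x01' : 0 < x < 1 by plra.
  have [d d0 [dr _]] := derive_gt0_local (energy_derive C b h x01') h1.
  pose m := Num.min (x + d) 1.
  have md : m <= x + d by rewrite ge_min lexx.
  have m1 : m <= 1 by rewrite ge_min lexx orbT.
  have mu : x < m by rewrite lt_min; plra.
  have /dr : x < (x + m) / 2 < x + d by lra.
  by rewrite ltNge xm.2//; plra.
have Fx : F1 b h x = 0.
  by have [] := @maximizer_critical _ _ _ _ _ _ _ _ _ _ C c b h x c0; [plra|done|].
have : 0 < F1 b h u by apply: (main u x) => //; plra.
by rewrite Fu ltxx.
Qed.

Lemma coexist_right_unique x : x0 <= x <= 1 -> x != v -> F b h x < F b h v.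
Proof.
move=> cx xu; rewrite lt_neqAle vm.2 ?andbT; last plra.
apply/eqP => xE.
have xm : maximizer_from c b h x by split=> [|y /vm.2]; [plra|rewrite xE].
have x1' : x < 1 by apply: (maximizer_lt1 C c0 _ xm); plra.
have main y z : y < z -> x0 <= y -> z < 1 -> maximizer_from c b h y ->
    F1 b h z < F1 b h y.
  move=> yz xy z1 ym.
  have [_ ry] := @maximizer_critical _ _ _ _ _ _ _ _ _ _ C c b h y c0 ltac:(plra) ym.
  apply: (energy1_gt C) => //; [plra..|] => t tyz.
  by apply: le_lt_trans ry _; apply: (rho_incr C); plra.
have [_ Fv] := coexist_critical.
have Fx : F1 b h x = 0.
  by have [] := @maximizer_critical _ _ _ _ _ _ _ _ _ _ C c b h x c0; [plra|done|].
case: (ltgtP x v) xu => // xu _.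
  have : F1 b h v < F1 b h x by apply: main => //; plra.
  by rewrite Fx Fv ltxx.
have : F1 b h x < F1 b h v by apply: main => //; plra.
by rewrite Fx Fv ltxx.
Qed.

Lemma coexist_A : A u < A x0 /\ A x0 < A v.
Proof.
split; last by apply: (A_lt C); plra.
have [ue|eu] := leP u e; first by apply: (A_left W); plra.
by apply: (A_lt C); plra.
Qed.

Lemma coexist_left_ge_e : 0 <= h -> e <= u.
Proof.
move=> h0; rewrite leNgt; apply/negP => ue.
have [Fu _] := coexist_critical.
have : F1 b h e < F1 b h u.
  apply: (energy1_gt C) => //; [plra..|] => z zue.
  by have := rho_left W (x := z); plra.
by rewrite Fu /energy1 (A1_e C) (S1_e C); lra.
Qed.

End Point.

End Curve.

Section CurveSmooth.
Context {R : realType}.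
Variables (A A1 A2 S S1 S2 rho : R -> R) (e x0 : R).
Implicit Types b c d h t u v x y z : R.

Hypothesis C : competition A A1 A2 S S1 S2 rho e x0.
Hypothesis ex : e < x0.

Hypothesis smooth_comp : forall n (U : set R) (w : R -> R),
  (forall h, U h -> 0 < w h < 1) -> diffn n U w ->
  [/\ diffn n U (A \o w), diffn n U (A1 \o w),
      diffn n U (A2 \o w) & diffn n U (S2 \o w)].

Local Notation F := (energy A S).
Local Notation F1 := (energy1 A1 S1).
Local Notation F2 := (energy2 A2 S2).
Local Notation maximizer_from := (maximizer_from A S).
Local Notation bt := (rho x0).
Local Notation ht := (h_deg A1 S1 rho x0).

Variables (c eps b1 x1 : R).
Hypothesis W : window A A1 S S1 rho e x0 c eps b1 x1.
Local Notation coexist := (coexist A S rho x0 c b1).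

Variables (g u v : R -> R).
Hypothesis P : forall h, - eps < h < ht -> coexist h (g h) (u h) (v h).
Local Notation I := [set h | - eps < h < ht].

Let e0 : 0 < e. Proof. by case: C. Qed.
Let x01 : x0 < 1. Proof. by case: C. Qed.
Let c0 : 0 < c. Proof. by case: W. Qed.
Let ce : c < e. Proof. by case: W. Qed.

(** Monotonicity of the subgradients, applied to the right maximizer at one point
of the curve and the left maximizer at the other. The two inequalities bound
the slope of every chord of the curve from both sides. *)
Lemma coexist_monotone h b x y h' b' x' y' : 
  coexist h b x y -> coexist h' b' x' y' ->
  (b' - b) * (A y - A x') + (h' - h) * (y - x') <= 0 /\
  0 <= (b' - b) * (A y' - A x) + (h' - h) * (y' - x).
Proof.
move=> [_ _ _ xm ym] [_ _ _ xm' ym'].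
have := maximizer_monotone ym xm'; have := maximizer_monotone xm ym'.
move: (A x) (A y) (A x') (A y') => ? ? ? ? ? ?; split; lra.
Qed.

Lemma coexist_ltr h b x y h' b' x' y' : 
  coexist h b x y -> coexist h' b' x' y' ->
  [/\ x < y', x' < y, A x < A y' & A x' < A y].
Proof.
move=> Q Q'; have [a1 a2] := coexist_A C ex W Q.
have [a1' a2'] := coexist_A C ex W Q'.
case: Q Q' => _ /andP[_ ?] /andP[? _] _ _ [_ /andP[_ ?] /andP[? _] _ _].
by split; [exact: (@lt_trans _ _ x0)|exact: (@lt_trans _ _ x0)|
           exact: (@lt_trans _ _ (A x0))|exact: (@lt_trans _ _ (A x0))].
Qed.

Lemma coexist_decr h b x y h' b' x' y' : 
  coexist h b x y -> coexist h' b' x' y' -> h < h' -> b' < b.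
Proof.
move=> Q Q' hh; have [M _] := coexist_monotone Q Q'.
have [_ xy _ Axy] := coexist_ltr Q Q'.
rewrite ltNge; apply/negP => bb.
have : 0 < (h' - h) * (y - x') by rewrite mulr_gt0// subr_gt0.
have : 0 <= (b' - b) * (A y - A x') by rewrite mulr_ge0// subr_ge0// ltW.
lra.
Qed.

(** The constant depends on the first point only, as the continuity of the curve
at that point requires. *)
Lemma coexist_lipschitz h b x y h' b' x' y' :
  coexist h b x y -> coexist h' b' x' y' ->
  `|b - b'| * Num.min (A x0 - A x) (A y - A x0) <= `|h - h'|.
Proof.
move=> Q Q'; set k := Num.min _ _.
have k1 : k <= A x0 - A x by rewrite ge_min lexx.
have k2 : k <= A y - A x0 by rewrite ge_min lexx orbT.
have [a1 a2] := coexist_A C ex W Q; have [a1' a2'] := coexist_A C ex W Q'.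
have k0 : 0 < k by rewrite lt_min !subr_gt0 a1.
have [_ M] := coexist_monotone Q Q'; have [_ M'] := coexist_monotone Q' Q.
have bound D a H r : 0 <= D -> k <= a -> 0 <= H -> r <= 1 -> D * a <= H * r ->
    D * k <= H.
  move=> D0 ka H0 r1 DH; apply: le_trans (ler_wpM2l D0 ka) (le_trans DH _).
  by rewrite ler_piMr.
have dec := coexist_decr Q Q'; have dec' := coexist_decr Q' Q.
have [N _] := coexist_monotone Q Q'; have [N' _] := coexist_monotone Q' Q.
have [_ _ A1' A2'] := coexist_ltr Q Q'.
case: Q Q' => _ /andP[cx xx] /andP[xy y1] _ _ [_ /andP[cx' xx'] /andP[xy' y1'] _ _].
case: (ltgtP h h') => hh.
- have bb : b' < b := dec hh; rewrite (gtr0_norm (x := b - b')) ?subr_gt0//.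
  rewrite ltr0_norm ?subr_lt0//; apply: (bound _ (A y' - A x) _ (y' - x)).
  + by rewrite subr_ge0 ltW.
  + by move: k1 a2'; lra.
  + by move: hh; lra.
  + by move: c0 cx y1'; lra.
  + by move: M; lra.
- have bb := dec' hh; rewrite (ltr0_norm (x := b - b')) ?subr_lt0//.
  rewrite gtr0_norm ?subr_gt0//; apply: (bound _ (A y - A x') _ (y - x')).
  + by move: bb; lra.
  + by move: k2 a1'; lra.
  + by move: hh; lra.
  + by move: c0 cx' y1; lra.
  + by move: M'; lra.
- move: N N'; rewrite hh subrr !mul0r !addr0 => N N'.
  have b1' : b' - b <= 0 by move: N; rewrite pmulr_lle0 ?subr_gt0.
  have b2' : b - b' <= 0 by move: N'; rewrite pmulr_lle0 ?subr_gt0.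
  have -> : b = b' by apply/eqP; rewrite eq_le -subr_le0 b2' -subr_le0.
  by rewrite subrr normr0 mul0r.
Qed.

Section AtPoint.
Variable h0 : R.
Hypothesis h0I : I h0.
Let P0 : coexist h0 (g h0) (u h0) (v h0). Proof. exact: P. Qed.

Lemma near_I : \forall h \near h0, I h.
Proof.
case/andP: h0I => l r; near=> h; apply/andP; split; near: h.
  exact: lt_nbhsr.
exact: lt_nbhsl.
Unshelve. all: by end_near. Qed.

Lemma curve_continuous : {for h0, continuous g}.
Proof.
have [a1 a2] := coexist_A C ex W P0.
pose k := Num.min (A x0 - A (u h0)) (A (v h0) - A x0).
have k0 : 0 < k by rewrite lt_min !subr_gt0 a1.
apply/cvgrPdist_lt => d d0; have nI := near_I; near=> h.
have Ph : coexist h (g h) (u h) (v h) by apply: P; near: h.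
rewrite -(ltr_pM2r k0); apply: le_lt_trans (coexist_lipschitz P0 Ph) _.
by near: h; apply: cvgr_dist_lt => //; rewrite mulr_gt0.
Unshelve. all: by end_near. Qed.

(** The perturbation of the energy is uniformly small, so [strict_max_gap]
applies. *)
Lemma maximizer_continuous (w : R -> R) l r : c <= l -> r <= 1 ->
  (forall h, I h -> l <= w h <= r /\
     forall x, l <= x <= r -> F (g h) h x <= F (g h) h (w h)) ->
  (forall x, l <= x <= r -> x != w h0 -> F (g h0) h0 x < F (g h0) h0 (w h0)) ->
  {for h0, continuous w}.
Proof.
move=> cl r1 wmax ustrict; apply/cvgrPdist_lt => d d0.
have Fc : continuous (F (g h0) h0) by exact: (energy_continuous C).
have [dl dl0 gap] := strict_max_gap Fc d0 ustrict.
have nI := near_I; have gc := curve_continuous; near=> h.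
have [wlr wm] : l <= w h <= r /\
     forall x, l <= x <= r -> F (g h) h x <= F (g h) h (w h).
  by apply: wmax; near: h.
have [w0lr _] := wmax _ h0I.
have gh : `|g h0 - g h| < dl / 4.
  by near: h; apply: cvgr_dist_lt; [exact: gc|lra].
have hh : `|h0 - h| < dl / 4 by near: h; apply: cvgr_dist_lt => //; lra.
rewrite ltNge distrC; apply/negP => /(gap _ wlr).
have in01 x : l <= x <= r -> 0 <= x <= 1 by have := c0; lra.
have := energy_perturb C (g h0) h0 (g h) h (in01 _ wlr).
have := energy_perturb C (g h0) h0 (g h) h (in01 _ w0lr).
have := wm _ w0lr; rewrite !ler_norml.
lra.
Unshelve. all: by end_near. Qed.

Lemma left_continuous : {for h0, continuous u}.
Proof.
apply: (@maximizer_continuous u c x0) => [//||h /P[_ cu _ [_ um] _]|x cx xu].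
- exact: ltW.
- case/andP: cu => cu ux; split=> [|x /andP[cx xx]].
    by rewrite !ltW.
  by apply: um; rewrite cx (le_trans xx)// ltW.
- exact: (coexist_left_unique C ex W P0).
Qed.

Lemma right_continuous : {for h0, continuous v}.
Proof.
apply: (@maximizer_continuous v x0 1) => [|//|h /P[_ _ xv _ [_ vm]]|x cx xu].
- exact/ltW/(lt_trans ce).
- case/andP: xv => xv v1; split=> [|x /andP[cx xx]].
    by rewrite !ltW.
  by apply: vm; rewrite xx (le_trans _ cx)// ltW// (lt_trans ce).
- exact: (coexist_right_unique C ex W P0).
Qed.

(** Clausius-Clapeyron relation: the slope of the curve is minus the ratio of
the jumps of the two conjugate quantities [x] and [A x]. *)
Lemma curve_derive :
  is_derive h0 1 g (- ((v h0 - u h0) / (A (v h0) - A (u h0)))).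
Proof.
pose q x y := - ((y - x) / (A y - A x)).
have [_ ux vx _ _] := P0; have [a1 a2] := coexist_A C ex W P0.
have cA (w : R -> R) : {for h0, continuous w} -> {for h0, continuous (A \o w)}.
  by move=> wc; apply: continuous_comp => //; exact: (A_cont C).
have Duv : A (v h0) - A (u h0) != 0 by rewrite subr_eq0 gt_eqF// (lt_trans a1).
apply: (@is_derive_squeeze _ g (fun z => q (u h0) (v z)) (fun z => q (u z) (v h0))) => //.
- apply: cvgN; apply: cvgM; first by apply: cvgB; [exact: right_continuous|exact: cvg_cst].
  by apply: cvgV => //; apply: cvgB; [apply: (cA v); exact: right_continuous|exact: cvg_cst].
- apply: cvgN; apply: cvgM; first by apply: cvgB; [exact: cvg_cst|exact: left_continuous].
  by apply: cvgV => //; apply: cvgB; [exact: cvg_cst|apply: (cA u); exact: left_continuous].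
have nI := near_I; near=> z => zh.
have Pz : coexist z (g z) (u z) (v z) by apply: P; near: z.
have [M1 M2] := coexist_monotone P0 Pz; have [L1 L2 L3 L4] := coexist_ltr P0 Pz.
have [N1 N2] := coexist_monotone Pz P0.
have key (r s D H : R) : 0 < r -> 0 < s -> 0 < H ->
    (D * r + H * s <= 0) = (D / H <= - (s / r)).
  move=> r0 s0 H0; rewrite -mulNr (ler_pdivrMr _ _ H0) mulrAC (ler_pdivlMr _ _ r0).
  by rewrite -[RHS]subr_le0; congr (_ <= _); ring.
have key' (r s D H : R) : 0 < r -> 0 < s -> 0 < H ->
    (0 <= D * r + H * s) = (- (s / r) <= D / H).
  move=> r0 s0 H0; rewrite -mulNr (ler_pdivlMr _ _ H0) mulrAC (ler_pdivrMr _ _ r0).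
  by rewrite -[RHS]subr_ge0; congr (_ <= _); ring.
rewrite ge_min le_max /q; case: (ltgtP z h0) zh => // zh _; last first.
  by move: M1 M2; rewrite key ?subr_gt0// key' ?subr_gt0// => -> ->; rewrite orbT.
have -> : (g z - g h0) / (z - h0) = (g h0 - g z) / (h0 - z).
  by rewrite -(opprB (g h0)) -(opprB h0) invrN mulrNN.
by move: N1 N2; rewrite key ?subr_gt0// key' ?subr_gt0// => -> ->; rewrite orbT.
Unshelve. all: by end_near. Qed.

(** Near [h0] the critical equation at [h] reads [F1 (g h0) h0 (w h) =
- ((g h - g h0) * A1 (w h) + (h - h0))], an implicit equation for [w] with a
fixed function on the left. *)
Lemma critical_point_derive (w : R -> R) dg :
  (forall h, I h -> 0 < w h < 1 /\ F1 (g h) h (w h) = 0) ->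
  {for h0, continuous w} -> g h0 < rho (w h0) -> is_derive h0 1 g dg ->
  is_derive h0 1 w (- (1 + dg * A1 (w h0)) / F2 (g h0) (w h0)).
Proof.
move=> wI wc gr dg'; have [w01 F1w] := wI _ h0I.
have F20 : F2 (g h0) (w h0) != 0 by rewrite lt_eqF// (energy2_lt0 C).
apply: (is_derive_implicit F20 (energy1_derive C (g h0) h0 w01) wc).
have A1c : {for h0, continuous (A1 \o w)}.
  apply: continuous_comp => //.
  exact: is_derive_continuous (A1_derive C w01).
have d1 : is_derive h0 1 (fun z => g z - g h0) dg.
  rewrite -[dg]subr0; apply: (@is_deriveB _ _ _ g (cst (g h0))).
have d2 : is_derive h0 1 (fun z => (g z - g h0) * (A1 \o w) z) (dg * A1 (w h0)).
  apply: (is_derive_vanishM (f := fun z => g z - g h0) (w := A1 \o w)) => //.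
  exact: subrr.
have d3 : is_derive h0 1 (fun z => z - h0) 1.
  by rewrite -[X in is_derive _ _ _ X]subr0; apply: (@is_deriveB _ _ _ id (cst h0)).
have d4 : is_derive h0 1 (fun z => - ((g z - g h0) * A1 (w z) + (z - h0)))
    (- (1 + dg * A1 (w h0))).
  by rewrite [1 + _]addrC; exact: is_deriveN (is_deriveD d2 d3).
apply: near_eq_is_derive d4; have nI := near_I; near=> z.
have [_ E] : 0 < w z < 1 /\ F1 (g z) z (w z) = 0 by apply: wI; near: z.
by move: E; rewrite /energy1 /= => E; rewrite -[RHS]subr0 -E; ring.
Unshelve. all: by end_near. Qed.

End AtPoint.

(** The derivatives of the curve and of its two maximizers are rational in
[A], [A1], [A2], [S2] at these maximizers, so that differentiability
bootstraps. *)
Lemma curve_diffn n : [/\ diffn n I g, diffn n I u & diffn n I v].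
Proof.
have crit h : I h -> [/\ 0 < u h < 1, 0 < v h < 1,
    F1 (g h) h (u h) = 0 & F1 (g h) h (v h) = 0].
  move=> /P Ph; have [Fu Fv] := coexist_critical C ex W Ph.
  case: Ph => _ /andP[cu ux] /andP[xv v1] _ _; split=> //.
    by rewrite (lt_trans c0 cu) (lt_trans ux).
  by rewrite v1 andbT (lt_trans _ xv)// (lt_trans e0).
elim: n => [//|n [Cg Cu Cv]].
have u01 h : I h -> 0 < u h < 1 by move=> /crit[].
have v01 h : I h -> 0 < v h < 1 by move=> /crit[].
have [CAu CA1u CA2u CS2u] := smooth_comp u01 Cu.
have [CAv CA1v CA2v CS2v] := smooth_comp v01 Cv.
pose g' h := - ((v h - u h) / (A (v h) - A (u h))).
have Cg' : diffn n I g'.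
  apply: diffnN; apply: diffnM; first exact: diffnB.
  apply: diffnV => [h /P Ph|]; last exact: (diffnB (f := A \o v) (g := A \o u)).
  by have [a1 a2] := coexist_A C ex W Ph; rewrite subr_eq0 gt_eqF// (lt_trans a1).
have main (w : R -> R) : diffn n I w -> diffn n I (A1 \o w) -> diffn n I (A2 \o w) ->
    diffn n I (S2 \o w) -> (forall h, I h -> 0 < w h < 1 /\ F1 (g h) h (w h) = 0) ->
    (forall h, I h -> {for h, continuous w}) -> (forall h, I h -> g h < rho (w h)) ->
    diffn n.+1 I w.
  move=> Cw CA1 CA2 CS2 wI wc gr.
  exists (fun h => - (1 + g' h * A1 (w h)) / F2 (g h) (w h)).
    by move=> h hI; apply: critical_point_derive => //; [exact: wc|exact: gr|exact: curve_derive].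
  apply: diffnM.
    apply: diffnN; apply: (diffnD (f := cst 1)); first exact: diffn_cst.
    exact: (diffnM (g := A1 \o w)).
  apply: diffnV => [h hI|].
    by rewrite lt_eqF// (energy2_lt0 C) ?gr//; have [] := wI _ hI.
  apply: (diffnD (g := S2 \o w)) => //; exact: (diffnM (g := A2 \o w)).
split.
- by exists g' => // h hI; exact: curve_derive.
- apply: main => // h hI; first by have [] := crit _ hI.
    exact: left_continuous.
  by have [] := coexist_curvature C ex W (P hI).
- apply: main => // h hI; first by have [] := crit _ hI.
    exact: right_continuous.
  by have [] := coexist_curvature C ex W (P hI).
Qed.

End CurveSmooth.

Section Coexist.
Context {R : realType}.
Variables (A A1 A2 S S1 S2 rho : R -> R) (e x0 : R).
Implicit Types b c d h t u v x y z : R.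

Hypothesis C : competition A A1 A2 S S1 S2 rho e x0.

Local Notation F := (energy A S).
Local Notation F1 := (energy1 A1 S1).
Local Notation maximizer_from := (maximizer_from A S).
Local Notation bt := (rho x0).
Local Notation ht := (h_deg A1 S1 rho x0).

Let e0 : 0 < e. Proof. by case: C. Qed.
Let ex0 : e <= x0. Proof. by case: C. Qed.
Let x01 : x0 < 1. Proof. by case: C. Qed.

Ltac clra := move: e0 ex0 x01 => ? ? ?; lra.

Definition coexistence b h :=
  exists u v, [/\ u < v, maximizer_from e b h u & maximizer_from e b h v].

(** Any right maximizer lies beyond any left one, on the other side of [x0], so
monotonicity of the subgradients makes [b] decrease when [h] increases. *)
Lemma coexistence_decr b h b' h' : 0 <= h -> h < h' ->
  coexistence b h -> coexistence b' h' -> b' < b.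
Proof.
move=> h0 hh [u [v [uv um vm]]] [u' [v' [uv' um' vm']]].
have [ux xv _] := two_maximizers C h0 uv um vm.
have [ux' xv' _] := two_maximizers C (le_trans h0 (ltW hh)) uv' um' vm'.
have := maximizer_monotone vm um'.
case: vm um' => /andP[_ v1] _ [/andP[eu' _] _].
have uv2 : u' < v by apply: lt_trans ux' xv.
have Auv := A_lt C eu' uv2 v1.
have H1 : 0 < (h' - h) * (v - u') by rewrite mulr_gt0 ?subr_gt0.
move=> M; rewrite ltNge; apply/negP => bb.
have : 0 <= (b' - b) * (A v - A u') by rewrite mulr_ge0 ?subr_ge0// ltW.
lra.
Qed.

Lemma coexistence_inj b b' h : 0 <= h ->
  coexistence b h -> coexistence b' h -> b = b'.
Proof.
have le a a' : 0 <= h -> coexistence a h -> coexistence a' h -> a' <= a.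
  move=> h0 [u [v [uv um vm]]] [u' [v' [uv' um' vm']]].
  have [ux xv _] := two_maximizers C h0 uv um vm.
  have [ux' xv' _] := two_maximizers C h0 uv' um' vm'.
  have := maximizer_monotone vm um'.
  case: vm um' => /andP[_ v1] _ [/andP[eu' _] _].
  have uv2 : u' < v by apply: lt_trans ux' xv.
  have Auv := A_lt C eu' uv2 v1.
  by rewrite subrr mul0r addr0 pmulr_lle0 ?subr_gt0// subr_le0.
by move=> h0 H H'; apply/eqP; rewrite eq_le (le _ _ h0 H' H) (le _ _ h0 H H').
Qed.

(** Compared with the degenerate point, a coexistence point with a larger field
would have [b <= rho x0], where the energy is concave. *)
Lemma coexistence_h_lt b h : 0 <= h -> coexistence b h -> h < ht.
Proof.
move=> h0 [u [v [uv um vm]]]; have [ux _ bb] := two_maximizers C h0 uv um vm.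
rewrite ltNge; apply/negP => hh.
have := maximizer_monotone (deg_maximizer C) um.
case: um => /andP[eu _] _; have Au := A_lt C eu ux (ltW x01).
have : 0 < (b - bt) * (A x0 - A u) by rewrite mulr_gt0 ?subr_gt0.
have : 0 <= (h - ht) * (x0 - u) by rewrite mulr_ge0 ?subr_ge0// ltW.
lra.
Qed.

Lemma A_slope u : e <= u -> u < x0 ->
  (A x0 - A e) * (x0 - u) <= (A x0 - A u) * (x0 - e).
Proof.
rewrite le_eqVlt => /predU1P[<-//|eu] ux.
have cA x y z : x <= z <= y -> {for z, continuous A} by move=> _; exact: (A_cont C).
have [|a /andP[ea au] Ea] := pointwise_MVT eu (@cA e u) (f1 := A1).
  by move=> x xe; apply: (A_derive C); clra.
have [|a' /andP[ua ax] Ea'] := pointwise_MVT ux (@cA u x0) (f1 := A1).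
  by move=> x xe; apply: (A_derive C); clra.
have : A1 a < A1 a'.
  apply: (derive_gt0_lt (f1 := A2)) => [|x xa|x xa|x xa]; first by clra.
  - by apply: is_derive_continuous (A1_derive C _); clra.
  - by apply: (A1_derive C); clra.
  - by apply: (A2_gt0 C); clra.
move=> aa; have : 0 <= (A1 a' - A1 a) * ((u - e) * (x0 - u)).
  by apply: mulr_ge0; [clra|apply: mulr_ge0; clra].
have -> : A x0 - A e = A1 a' * (x0 - u) + A1 a * (u - e) by clra.
rewrite Ea'; lra.
Qed.

(** Convexity of [A] turns monotonicity of the maximizers, compared with the
degenerate point, into a Lipschitz bound at the end of the curve. *)
Lemma coexistence_near_deg b h : e < x0 -> 0 <= h -> coexistence b h ->
  bt < b /\ (b - bt) * (A x0 - A e) <= (ht - h) * (x0 - e).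
Proof.
move=> ex h0 [u [v [uv um vm]]]; have [ux _ bb] := two_maximizers C h0 uv um vm.
split=> //; have := maximizer_monotone um (deg_maximizer C).
case: um => /andP[eu _] _; have sl := A_slope eu ux => M.
rewrite -(ler_pM2r (_ : 0 < x0 - u)) ?subr_gt0//.
rewrite -mulrA; apply: (@le_trans _ _ ((b - bt) * ((A x0 - A u) * (x0 - e)))).
  by rewrite ler_wpM2l// subr_ge0 ltW.
have -> : (b - bt) * ((A x0 - A u) * (x0 - e)) =
    (b - bt) * (A x0 - A u) * (x0 - e) by ring.
have -> : (ht - h) * (x0 - e) * (x0 - u) = (ht - h) * (x0 - u) * (x0 - e) by ring.
rewrite ler_pM2r ?subr_gt0//; lra.
Qed.

(** Without field [e] is critical, and the energy is concave between [e] and the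
left maximizer, which therefore is [e]. *)
Lemma coexistence_left_e b : coexistence b 0 -> maximizer_from e b 0 e.
Proof.
move=> [u [v [uv um vm]]]; have [ux _ bb] := two_maximizers C (lexx _) uv um vm.
have br := maximizer_nondegenerate C (lexx _) um (negbT (lt_eqF ux)).
have Fu := maximizer_from_e_critical C (lexx _) um.
case: (um) => /andP[]; rewrite le_eqVlt => /predU1P[eu _ _|eu _ _].
  by move: um; rewrite -eu.
have : F1 b 0 u < F1 b 0 e.
  apply: (energy1_gt C) => //; [clra..|] => z /andP[ez zu].
  by apply: lt_trans br _; apply: (rho_decr C); clra.
by rewrite Fu /energy1 (A1_e C) (S1_e C) mulr0 !addr0 ltxx.
Qed.

(** [A] increases on [[e, 1]]: if [x > e] beats [e] at some [b] then it beats it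
strictly at every larger one. *)
Lemma coexistence_threshold b b' x : coexistence b' 0 ->
  maximizer_from e b 0 x -> e < x -> b' <= b.
Proof.
move=> /coexistence_left_e em xm ex; have := maximizer_monotone xm em.
case: xm => /andP[_ x1] _; have Ae := A_lt C (lexx _) ex x1.
by rewrite subrr mul0r addr0 pmulr_lle0 ?subr_gt0// subr_le0.
Qed.

Section Exists.
Hypothesis ex : e < x0.
Hypothesis smooth_comp : forall n (U : set R) (w : R -> R),
  (forall h, U h -> 0 < w h < 1) -> diffn n U w ->
  [/\ diffn n U (A \o w), diffn n U (A1 \o w),
      diffn n U (A2 \o w) & diffn n U (S2 \o w)].

Lemma coexistence_curve : exists2 eps, 0 < eps & exists2 g : R -> R,
  (forall n, diffn n [set h | - eps < h < ht] g) &
  (forall h, 0 <= h < ht -> coexistence (g h) h).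
Proof.
have [c [eps [b1 [x1 W]]]] := window_exists C ex.
have /choice[p pP] : forall h, exists p : R * R * R, - eps < h < ht ->
    coexist A S rho x0 c b1 h p.1.1 p.1.2 p.2.
  move=> h; have [hI|_] := boolP (- eps < h < ht); last by exists (0, 0, 0).
  by have [b [u [v P]]] := coexist_exists C ex W hI; exists (b, u, v).
have eps0 := eps_gt0 W.
exists eps => //; exists (fun h => (p h).1.1).
  move=> n.
  by have [] := @curve_diffn _ _ _ _ _ _ _ _ _ _ C ex smooth_comp _ _ _ _ W
    (fun h => (p h).1.1) (fun h => (p h).1.2) (fun h => (p h).2) pP n.
move=> h /andP[h0 hh]; have hI : - eps < h < ht by rewrite hh andbT; lra.
have P := pP h hI; have eu := coexist_left_ge_e C ex W P h0.
have ce := c_lt_e W; case: P => _ /andP[_ ux] /andP[xv v1] [_ um] [_ vm].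
exists (p h).1.2, (p h).2; split; first exact: lt_trans ux xv.
- by split=> [|y ye]; [|apply: um]; clra.
- by split=> [|y ye]; [|apply: vm]; clra.
Qed.

Lemma coexistence_curve_limit (g : R -> R) :
  (forall h, 0 <= h < ht -> coexistence (g h) h) -> g h @[h --> ht^'-] --> bt.
Proof.
move=> gP; have ht0 := h_deg_gt0 C ex.
have Ae : 0 < A x0 - A e by rewrite subr_gt0 (A_lt C)// ltW.
have k0 : 0 < (x0 - e) / (A x0 - A e) by rewrite divr_gt0// subr_gt0.
apply/cvgrPdist_lt => d d0; near=> h.
have hh : h < ht by near: h; exact: nbhs_left_lt.
have h0 : 0 <= h by apply/ltW; near: h; exact: nbhs_left_gt.
have [bb B] : bt < g h /\ (g h - bt) * (A x0 - A e) <= (ht - h) * (x0 - e).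
  by apply: coexistence_near_deg => //; apply: gP; rewrite h0.
rewrite ltr0_norm ?subr_lt0// opprB.
have hd : ht - h < d / ((x0 - e) / (A x0 - A e)).
  rewrite ltrBlDr -ltrBlDl; near: h; apply: nbhs_left_gt.
  by rewrite ltrBlDr ltrDl divr_gt0.
apply: (@le_lt_trans _ _ ((ht - h) * ((x0 - e) / (A x0 - A e)))).
  by rewrite mulrA ler_pdivlMr.
by rewrite -ltr_pdivlMr.
Unshelve. all: by end_near. Qed.

End Exists.

End Coexist.

(** * The curvature profile *)

Section SignPolynomial.
Context {R : realType}.
Implicit Types (f g : R -> R) (x y z : R).

(** A form of single change of sign, from positive to negative, that passes to
primitives without locating the change. *)
Definition falls_once f := forall x y, 1 < x -> x < y -> f x <= 0 -> f y < 0.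

(** Once such a derivative is nonpositive it stays negative, so an antiderivative
starting at a nonnegative value cannot come back. *)
Lemma falls_once_primitive f g :
  (forall x, is_derive x 1 f (g x)) -> 0 <= f 1 -> falls_once g -> falls_once f.
Proof.
move=> df f1 Dg x y x1 xy fx.
have cf x' y' z : x' <= z <= y' -> {for z, continuous f}.
  by move=> _; exact: is_derive_continuous (df z).
have [z /andP[z1 zx] E] := pointwise_MVT x1 (@cf 1 x) (fun z _ => df z).
have gz : g z <= 0.
  rewrite -(pmulr_lle0 _ (_ : 0 < x - 1)) ?subr_gt0// -E; lra.
apply: lt_le_trans fx; apply: (derive_lt0_gt xy (@cf x y) (fun z _ => df z)).
by move=> t /andP[xt ty]; apply: Dg gz => //; lra.
Qed.

(** With [n = q - 1] and [y] the ratio of the two values taken by the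
coordinates, this has the sign of the slope of the curvature profile. *)
Definition slope_poly (p : nat) (n y : R) : R :=
  n ^+ 2 * (p%:R - 1) * y ^+ (p - 2) - n * y ^+ (p - 1) + n - (p%:R - 1) * y.

(** For [p <= 3] the polynomial is at most quadratic and concave. For [p >= 4] its
second derivative is a positive factor times an affine decreasing function,
and two integrations from the nonnegative values of the derivative and of the
polynomial at [1] preserve the single change of sign. *)
Lemma slope_poly_falls_once p n : (2 <= p)%N -> 1 <= n ->
  falls_once (slope_poly p n).
Proof.
case: p => [|[|[|[|k]]]] // _ n1.
- have -> : slope_poly 2 n = fun y => (n + 1) * (n - y).
    by apply/funext => y; rewrite /slope_poly expr0 expr1; ring.
  move=> x y x1 xy; rewrite pmulr_rle0 ?pmulr_rlt0; lra.
- apply: (@falls_once_primitive _ (fun y => 2 * (n ^+ 2 - 1) - 2 * n * y)).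
  + move=> x; have -> : slope_poly 3 n = fun y => 2 * (n ^+ 2 - 1) * y - n * (y * y) + n.
      by apply/funext => y; rewrite /slope_poly expr1 expr2; ring.
    apply: (@is_derive_eq _ _ _ ((2 * (n ^+ 2 - 1)) \*: id - n \*: (id * id) + cst n)).
    rewrite /GRing.scale /=; ring.
  + rewrite /slope_poly !expr1n; nra.
  + move=> x y x1 xy fx; have : 2 * n * x < 2 * n * y by rewrite ltr_pM2l//; lra.
    lra.
- pose m : R := k%:R.
  have m0 : 0 <= m by exact: ler0n.
  have X := is_derive_expr.
  pose P1 y := n ^+ 2 * (m + 3) * (m + 2) * y ^+ k.+1 - n * (m + 3) * y ^+ k.+2 - (m + 3).
  pose P2 y := n ^+ 2 * (m + 3) * (m + 2) * (m + 1) * y ^+ k - n * (m + 3) * (m + 2) * y ^+ k.+1.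
  have n21 : 1 <= n ^+ 2 by rewrite exprn_ege1.
  have E1 : k.+1%:R = m + 1 :> R by rewrite -[k.+1]addn1 natrD.
  have E2 : k.+2%:R = m + 2 :> R by rewrite -[k.+2]addn2 natrD.
  have E3 : k.+3%:R = m + 3 :> R by rewrite -[k.+3]addn3 natrD.
  have pE : k.+4%:R = m + 4 :> R by rewrite -[k.+4]addn4 natrD.
  apply: (@falls_once_primitive _ P1).
  + move=> y.
    have -> : slope_poly k.+4 n = (n ^+ 2 * (m + 3)) \*: (fun y => y ^+ k.+2)
         - n \*: (fun y => y ^+ k.+3) + cst n - (m + 3) \*: id.
      apply/funext => z.
      change (slope_poly k.+4 n z =
        n ^+ 2 * (m + 3) * z ^+ k.+2 - n * z ^+ k.+3 + n - (m + 3) * z).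
      by rewrite /slope_poly pE !subSS !subn0; ring.
    have D2 := X _ k.+2 y; have D3 := X _ k.+3 y.
    apply: is_derive_eq; rewrite /GRing.scale /= /P1.
    rewrite E2 E3 /=; ring.
  + rewrite /slope_poly !expr1n pE; nra.
  + apply: (@falls_once_primitive _ P2).
    * move=> y.
      have -> : P1 = (n ^+ 2 * (m + 3) * (m + 2)) \*: (fun y => y ^+ k.+1)
           - (n * (m + 3)) \*: (fun y => y ^+ k.+2) - cst (m + 3) by [].
      have D2 := X _ k.+1 y; have D3 := X _ k.+2 y.
      apply: is_derive_eq; rewrite /GRing.scale /= /P2.
      by rewrite E1 E2 /= subr0 !mulrA.
    * rewrite /P1 !expr1n !mulr1.
      have : 0 <= (m + 3) * (n ^+ 2 * (m + 2) - n - 1).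
        by apply: mulr_ge0; nra.
      lra.
    * move=> x y x1 xy.
      have PE (z : R) : P2 z = z ^+ k * (n * (m + 3) * (m + 2)) * (n * (m + 1) - z).
        by rewrite /P2 [z ^+ k.+1]exprS; ring.
      have pos (z : R) : 1 < z -> 0 < z ^+ k * (n * (m + 3) * (m + 2)).
        by move=> z1; rewrite mulr_gt0 ?exprn_gt0 ?mulr_gt0//; lra.
      rewrite !PE pmulr_rle0 ?pos// pmulr_rlt0 ?pos//; lra.
Qed.

End SignPolynomial.

Section Profile.
Context {R : realType}.
Variables (p q : nat).
Hypotheses (hp : (2 <= p)%N) (hq : (2 <= q)%N).
Implicit Types x y z : R.

Local Notation n := (q%:R - 1 : R).
Local Notation e := (q%:R^-1 : R).

(** When one coordinate of a probability vector is [x] and the [q - 1] others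
are equal, [other x] is their value. *)
Definition other x := (1 - x) / n.
Definition alignment x := x ^+ p + n * other x ^+ p.
Definition alignment1 x := p%:R * (x ^+ (p - 1) - other x ^+ (p - 1)).
Definition alignment2 x := p%:R * (p%:R - 1) * (x ^+ (p - 2) + other x ^+ (p - 2) / n).
Definition entropy x := - (x * ln x) - (1 - x) * ln (1 - x) + (1 - x) * ln n.
Definition entropy1 x := - ln x + ln (1 - x) - ln n.
Definition entropy2 x := - (x^-1 + (1 - x)^-1).
(** The second derivative of the energy is [p (p - 1) b weight x - 1] divided by
[x (1 - x)]. *)
Definition weight x := (1 - x) * x ^+ (p - 1) + x * other x ^+ (p - 1).
Definition weight1 x := other x ^+ (p - 1) * slope_poly p n (x / other x) / n.
Definition flat_beta x := (p%:R * (p%:R - 1) * weight x)^-1.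

Let n_ge1 : 1 <= n.
Proof. by rewrite lerBrDr -(natrD _ 1 1) ler_nat. Qed.
Let n_gt0 : 0 < n. Proof. exact: lt_le_trans n_ge1. Qed.
Let n_neq0 : n != 0. Proof. by rewrite gt_eqF. Qed.
Let p_ge2 : 2 <= p%:R :> R. Proof. by rewrite ler_nat. Qed.
Let pE : p = (p - 2).+2. Proof. by rewrite -addn2 subnK. Qed.
Let pp_gt0 : 0 < p%:R * (p%:R - 1) :> R.
Proof. by rewrite mulr_gt0//; move: p_ge2 => ?; lra. Qed.

Lemma e_bounds : 0 < e <= 1 / 2.
Proof.
by rewrite invr_gt0 div1r lef_pV2 ?posrE ?ltr0n ?ler_nat ?hq ?(leq_trans _ hq).
Qed.

Lemma other_e : other e = e.
Proof. by rewrite /other; field; rewrite n_neq0 pnatr_eq0 -lt0n (leq_trans _ hq). Qed.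

Lemma other_gt0 x : x < 1 -> 0 < other x.
Proof. by move=> x1; rewrite divr_gt0// subr_gt0. Qed.

Lemma other_le1 x : 0 <= x <= 1 -> 0 <= other x <= 1.
Proof.
move=> /andP[x0 x1]; apply/andP; split.
  by apply: divr_ge0; [rewrite subr_ge0|exact: ltW].
by rewrite ler_pdivrMr// mul1r; have := n_ge1; lra.
Qed.

Lemma mul_n_other x : n * other x = 1 - x.
Proof. by rewrite mulrC divfK. Qed.

Lemma is_derive_other x : is_derive x 1 other (- n^-1).
Proof.
have -> : other = n^-1 \*: (cst 1 - id).
  by apply/funext => z; rewrite /other mulrC.
by apply: is_derive_eq; rewrite /GRing.scale /= sub0r mulrN1.
Qed.

Lemma is_derive_otherX k x :
  is_derive x 1 (fun z => other z ^+ k) (- (k%:R * other x ^+ k.-1 / n)).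
Proof.
have := is_derive1_comp (is_derive_expr k (other x)) (is_derive_other x).
by rewrite mulrN.
Qed.

Lemma is_derive_onem x : is_derive x 1 (fun z : R => 1 - z) (- 1).
Proof.
have -> : (fun z : R => 1 - z) = cst 1 - id by [].
by apply: is_derive_eq; rewrite sub0r.
Qed.

Lemma alignment_derive x : is_derive x 1 alignment (alignment1 x).
Proof.
have DX := is_derive_expr p x; have DO := is_derive_otherX p x.
have -> : alignment = (fun z => z ^+ p) + n \*: (fun z => other z ^+ p) by [].
apply: is_derive_eq; rewrite /GRing.scale /= /alignment1 subn1.
by field.
Qed.

Lemma alignment1_derive x : is_derive x 1 alignment1 (alignment2 x).
Proof.
have DX := is_derive_expr (p - 1) x; have DO := is_derive_otherX (p - 1) x.
have -> : alignment1 = p%:R \*: ((fun z => z ^+ (p - 1)) - (fun z => other z ^+ (p - 1))) by [].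
apply: is_derive_eq; rewrite /GRing.scale /= /alignment2.
rewrite -!subn1 -subnDA natrB ?(leq_trans _ hp)//.
by field.
Qed.

Lemma entropy_derive x : 0 < x < 1 -> is_derive x 1 entropy (entropy1 x).
Proof.
move=> /andP[x0 x1]; have x10 : 0 < 1 - x by rewrite subr_gt0.
have dl := is_derive1_ln x0.
have d1 := is_derive_onem x.
have dl1 := @is_derive1_comp R (@ln R) (fun z => 1 - z) x _ _ (is_derive1_ln x10) d1.
have -> : entropy = - (id * ln (R := R)) - (fun z => 1 - z) * (ln (R := R) \o (fun z => 1 - z))
    + ln n \*: (fun z => 1 - z).
  by apply/funext => z; rewrite /entropy; congr (_ + _); rewrite mulrC.
apply: is_derive_eq; rewrite /GRing.scale /= /entropy1.
by field; rewrite !gt_eqF.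
Qed.

Lemma entropy1_derive x : 0 < x < 1 -> is_derive x 1 entropy1 (entropy2 x).
Proof.
move=> /andP[x0 x1]; have x10 : 0 < 1 - x by rewrite subr_gt0.
have dl := is_derive1_ln x0.
have d1 := is_derive_onem x.
have dl1 := @is_derive1_comp R (@ln R) (fun z => 1 - z) x _ _ (is_derive1_ln x10) d1.
have -> : entropy1 = - (ln (R := R)) + (ln (R := R) \o (fun z => 1 - z)) - cst (ln n) by [].
apply: is_derive_eq; rewrite /entropy2.
by ring.
Qed.

(** At [0], the bound [ln y < y] applied to the inverse square root of [x] gives
[|x ln x| <= 2 sqrt x]. *)
Lemma xlnx_continuous : continuous (fun x => x * ln x).
Proof.
move=> x; case: (ltgtP x 0) => x0.
- rewrite /continuous_at (ln0 (ltW x0)) mulr0.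
  apply: cvg_near_cst; near=> y.
  have y0 : y < 0 by near: y; exact: lt_nbhsl.
  by rewrite (ln0 (ltW y0)) mulr0.
- by apply: cvgM; [exact: cvg_id|exact: continuous_ln].
- rewrite /continuous_at x0 mul0r.
  have sq : 2 * Num.sqrt `|y| @[y --> (0 : R)] --> (0 : R).
    suff : 2 * Num.sqrt `|y| @[y --> (0 : R)] --> 2 * Num.sqrt `|0 : R|.
      by rewrite normr0 sqrtr0 mulr0.
    apply: cvgM; first exact: cvg_cst.
    apply: (@continuous_comp _ _ _ (fun y : R => `|y|) Num.sqrt).
      exact: norm_continuous.
    exact: sqrt_continuous.
  apply/norm_cvg0P; apply: squeeze_cvgr (cvg_cst 0) sq; near=> y.
  rewrite normr_ge0 /=.
  have [y0|y0] := leP y 0; first by rewrite (ln0 y0) mulr0 normr0 mulr_ge0// sqrtr_ge0.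
  have y1 : y < 1 by near: y; apply: lt_nbhsl; exact: ltr01.
  have s0 : 0 < Num.sqrt y by rewrite sqrtr_gt0.
  have yE : y = Num.sqrt y * Num.sqrt y by rewrite -expr2 sqr_sqrtr// ltW.
  have lnE : ln y = ln (Num.sqrt y) + ln (Num.sqrt y).
    by rewrite {1}yE lnM ?posrE.
  have := @ln_sublinear _ (Num.sqrt y)^-1; rewrite invr_gt0 => /(_ s0).
  rewrite lnV ?posrE// => lt.
  have ly : ln y <= 0 by apply: ln_le0; exact: ltW.
  rewrite normrM (gtr0_norm y0) (ler0_norm ly).
  apply: (@le_trans _ _ (y * (2 * (Num.sqrt y)^-1))).
    by rewrite ler_pM2l//; lra.
  by rewrite {1}yE mulrCA -mulrA mulfV ?gt_eqF// mulr1.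
Unshelve. all: by end_near. Qed.

Lemma alignment_continuous : continuous alignment.
Proof. by move=> x; exact: is_derive_continuous (alignment_derive x). Qed.

Lemma entropy_continuous : continuous entropy.
Proof.
move=> x; have c1 : {for x, continuous (fun z : R => 1 - z)}.
  exact: is_derive_continuous (is_derive_onem x).
apply: cvgD; last by apply: cvgM; [exact: c1|exact: cvg_cst].
apply: cvgB; first by apply: cvgN; exact: xlnx_continuous.
apply: (@continuous_comp _ _ _ (fun z : R => 1 - z) (fun z => z * ln z)) => //.
exact: xlnx_continuous.
Qed.

Lemma alignment_norm_le1 x : 0 <= x <= 1 -> `|alignment x| <= 1.
Proof.
move=> x01; have /andP[b0 b1] := other_le1 x01; case/andP: x01 => x0 x1.
rewrite ger0_norm /alignment ?addr_ge0 ?mulr_ge0 ?exprn_ge0// ?(ltW n_gt0)//.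
rewrite [leRHS](_ : 1 = x + n * other x); last by rewrite mul_n_other; ring.
have le1 y : 0 <= y -> y <= 1 -> y ^+ p <= y.
  by move=> y0 y1; rewrite pE exprS ler_piMr// exprn_ile1.
by apply: lerD; [exact: le1|apply: ler_wpM2l; [exact: ltW|exact: le1]].
Qed.

Lemma alignment1_norm_le x : 0 <= x <= 1 -> `|alignment1 x| <= p%:R.
Proof.
move=> x01; have /andP[b0 b1] := other_le1 x01; case/andP: x01 => x0 x1.
rewrite /alignment1 normrM ger0_norm// ler_piMr//.
have h1 : 0 <= x ^+ (p - 1) <= 1 by rewrite exprn_ge0// exprn_ile1.
have h2 : 0 <= other x ^+ (p - 1) <= 1 by rewrite exprn_ge0// exprn_ile1.
by rewrite ler_norml; lra.
Qed.

Lemma alignment2_gt0 x : 0 < x < 1 -> 0 < alignment2 x.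
Proof.
move=> /andP[x0 x1]; rewrite /alignment2 mulr_gt0// addr_gt0 ?exprn_gt0//.
by rewrite divr_gt0// exprn_gt0// other_gt0.
Qed.

Lemma weight_gt0 x : 0 < x < 1 -> 0 < weight x.
Proof.
move=> /andP[x0 x1].
by rewrite /weight addr_gt0// mulr_gt0 ?exprn_gt0 ?other_gt0// subr_gt0.
Qed.

Lemma entropy2E x : 0 < x < 1 -> entropy2 x = - (alignment2 x * flat_beta x).
Proof.
move=> x01; have w0 := weight_gt0 x01; case/andP: x01 => x0 x1.
have x1' : 1 - x != 0 by rewrite gt_eqF// subr_gt0.
have wE : weight x = x * (1 - x) * (x ^+ (p - 2) + other x ^+ (p - 2) / n).
  rewrite /weight {1 2}pE subn1 /= !exprS mulrDr; congr (_ + _); first by ring.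
  by rewrite /other; ring.
have s0 : x ^+ (p - 2) + other x ^+ (p - 2) / n != 0.
  by apply: contraTneq w0 => s0; rewrite wE s0 mulr0 ltxx.
have pp0 : p%:R * (p%:R - 1) != 0 :> R by rewrite gt_eqF.
rewrite /entropy2 /alignment2 /flat_beta wE; congr (- _).
move: (x ^+ (p - 2) + _) s0 pp0 => s s0; move: (p%:R * (p%:R - 1)) => pp pp0.
by field; rewrite x1' (gt_eqF x0) pp0 s0.
Qed.

(** The entropy has slope minus infinity at [1]. *)
Lemma energy1_near_1 b h : exists2 d : R, d < 1 &
  forall x, d < x < 1 -> b * alignment1 x + h + entropy1 x < 0.
Proof.
pose K := `|b| * p%:R + h + ln 2 - ln n.
have E0 : 0 < expR (- K) by exact: expR_gt0.
exists (Num.max (1 / 2) (1 - expR (- K))).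
  by rewrite gt_max; apply/andP; split; lra.
move=> x; rewrite gt_max => /andP[/andP[x2 xK] x1].
have x0 : 0 < x by lra.
have xu : 0 <= x <= 1 by rewrite !ltW.
have : b * alignment1 x <= `|b| * p%:R.
  apply: le_trans (ler_norm _) _; rewrite normrM.
  by apply: ler_wpM2l => //; exact: alignment1_norm_le.
have : - ln x < ln 2.
  rewrite -lnV ?posrE// ltr_ln ?posrE ?invr_gt0//.
  by rewrite -[2]invrK ltf_pV2 ?posrE ?invr_gt0//; lra.
have : ln (1 - x) < - K.
  rewrite -[- K]expRK ltr_ln ?posrE ?expR_gt0 ?subr_gt0//; lra.
rewrite /K /entropy1; lra.
Qed.

Lemma alignment1_e : alignment1 e = 0.
Proof. by rewrite /alignment1 other_e subrr mulr0. Qed.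

Lemma entropy1_e : entropy1 e = 0.
Proof.
have /andP[e0 _] := e_bounds.
by rewrite /entropy1 -mul_n_other other_e lnM ?posrE//; ring.
Qed.

(** ** The peak of the weight *)

Lemma weight_derive x : x < 1 -> is_derive x 1 weight (weight1 x).
Proof.
move=> x1; have b0 := other_gt0 x1; have d1 := is_derive_onem x.
have DX := is_derive_expr (p - 1) x; have DO := is_derive_otherX (p - 1) x.
have -> : weight = (fun z => 1 - z) * (fun z => z ^+ (p - 1)) +
    id * (fun z => other z ^+ (p - 1)) by [].
apply: is_derive_eq; rewrite /GRing.scale /= /weight1 /slope_poly.
have pE1 : p%:R - 1 = (p - 1)%:R :> R by rewrite natrB// (leq_trans _ hp).
rewrite pE1; have -> : (p - 1)%N = (p - 2).+1 by lia.
rewrite -(mul_n_other x) /= !exprS.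
move: (p - 2)%N => k; move: (other x) b0 => b b0; rewrite !exprMn !exprVn.
have bk : b ^+ k != 0 by rewrite expf_neq0// gt_eqF.
move: (b ^+ k) bk => bb bk; move: (x ^+ k) (k.+1%:R) => xx kk.
by field; rewrite n_neq0 bk gt_eqF.
Qed.

Lemma weight_continuous : continuous weight.
Proof.
move=> x; have c1 := is_derive_continuous (is_derive_onem x).
have cX := is_derive_continuous (is_derive_expr (p - 1) x).
have cO := is_derive_continuous (is_derive_otherX (p - 1) x).
by apply: cvgD; apply: cvgM; [exact: c1|exact: cX|exact: cvg_id|exact: cO].
Qed.

Lemma ratio_gt1 x : e < x < 1 -> 1 < x / other x.
Proof.
move=> /andP[ex x1]; have b0 := other_gt0 x1.
rewrite ltr_pdivlMr// mul1r -(ltr_pM2l n_gt0) mul_n_other.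
have q0 : 0 < q%:R :> R by rewrite ltr0n (leq_trans _ hq).
have : 1 < q%:R * x by rewrite -ltr_pdivrMl// mulr1.
lra.
Qed.

Lemma weight1_sign x : x < 1 ->
  (weight1 x <= 0) = (slope_poly p n (x / other x) <= 0) /\
  (weight1 x < 0) = (slope_poly p n (x / other x) < 0).
Proof.
move=> x1; have b0 := other_gt0 x1; have bk0 := exprn_gt0 (p - 1) b0.
by rewrite /weight1 mulrAC pmulr_rle0 ?pmulr_rlt0 ?divr_gt0.
Qed.

Lemma weight1_falls x y : e < x -> x < y -> y < 1 -> weight1 x <= 0 -> weight1 y < 0.
Proof.
move=> ex xy y1; have x1 := lt_trans xy y1.
have [-> _] := weight1_sign x1; have [_ ->] := weight1_sign y1.
apply: slope_poly_falls_once => //; first by apply: ratio_gt1; rewrite ex.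
have /andP[e0 _] := e_bounds; have y0 : 0 < y by lra.
apply: (@lt_le_trans _ _ (y / other x)).
  by rewrite ltr_pM2r ?invr_gt0 ?other_gt0.
rewrite ler_pM2l// lef_pV2 ?posrE ?other_gt0// ler_pM2r ?invr_gt0//; lra.
Qed.

(** The peak may be at [e]: then [weight1] cannot be nonnegative anywhere, as it
would have been positive before and [weight] would exceed [weight e]. *)
Lemma weight_peak : exists2 x0, e <= x0 < 1 &
  [/\ (forall x, e <= x <= 1 -> weight x <= weight x0),
      (forall x, e < x < x0 -> 0 < weight1 x) &
      (forall x, x0 < x < 1 -> weight1 x < 0)].
Proof.
have /andP[e0 e2] := e_bounds.
have e1 : e < 1 by lra.
have [x0 /andP[ex0 x01] xmax] := max_on_segment (ltW e1) weight_continuous.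
have x0lt1 : x0 < 1.
  rewrite lt_neqAle x01 andbT; apply/eqP => xE.
  have : weight e <= weight x0 by apply: xmax; lra.
  rewrite xE {2}/weight /other subrr !mul0r expr0n.
  have -> : (p - 1 == 0)%N = false by lia.
  by rewrite mulr0 addr0 leNgt weight_gt0// e0.
have dw z : e < z < 1 -> is_derive z 1 weight (weight1 z).
  by move=> /andP[_ z1]; exact: weight_derive.
exists x0; first by rewrite ex0.
case: (ltgtP e x0) ex0 => // [ex|exE] _.
  have w0 : weight1 x0 = 0.
    apply: (@interior_max_derive _ weight x0 _ e 1); rewrite ?ex//.
      by apply: dw; rewrite ex.
    by move=> y /andP[ey y1]; apply: xmax; rewrite !ltW.
  split=> // x /andP[a b].
    by rewrite ltNge; apply/negP => /(weight1_falls a b x0lt1); rewrite w0 ltxx.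
  by apply: (weight1_falls ex a b); rewrite w0.
split=> // x /andP[a b]; first by lra.
rewrite -exE in a xmax; rewrite ltNge; apply/negP => wx.
have : weight e < weight x.
  apply: (derive_gt0_lt (f1 := weight1) a) => z zx; first exact: weight_continuous.
    by apply: dw; lra.
  case/andP: zx => ez zx.
  by rewrite ltNge; apply/negP => /(weight1_falls ez zx b); rewrite ltNge wx.
by rewrite ltNge xmax//; lra.
Qed.

(** For [q > 2] the polynomial is positive at [1]. For [q = 2] it vanishes at [1],
with derivative [(p - 1) (p - 4)]. *)
Lemma slope_poly_pos : q <> 2%N \/ (5 <= p)%N ->
  exists2 y, 1 < y & 0 < slope_poly p n y.
Proof.
move=> Hpq; pose d : R := (p%:R - 1) * (n ^+ 2 * (p%:R - 2) - n - 1).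
have dP : is_derive (1 : R) 1 (slope_poly p n) d.
  have D1 := is_derive_expr (p - 2) (1 : R); have D2 := is_derive_expr (p - 1) (1 : R).
  have -> : slope_poly p n = (n ^+ 2 * (p%:R - 1)) \*: (fun y => y ^+ (p - 2))
     - n \*: (fun y => y ^+ (p - 1)) + cst n - (p%:R - 1) \*: id by [].
  apply: is_derive_eq; rewrite /GRing.scale /= !expr1n /d.
  by rewrite !natrB// ?(leq_trans _ hp)//; ring.
have P1 : slope_poly p n 1 = (p%:R - 1) * (n ^+ 2 - 1).
  by rewrite /slope_poly !expr1n; ring.
have pm1 : 0 < p%:R - 1 :> R by move: p_ge2 => ?; lra.
case: (ltngtP q 2) => [|q3|q2]; first by rewrite ltnNge hq.
  have n2 : 2 <= n by rewrite lerBrDr -(natrD _ 2 1) ler_nat.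
  have P1pos : 0 < slope_poly p n 1.
    by rewrite P1 mulr_gt0//; nra.
  have := cvgr_gt _ (is_derive_continuous dP) _ P1pos => -[r /= r0 Hr].
  exists (1 + r / 2); first by lra.
  by apply: Hr; rewrite /= /ball_ /= ltr0_norm; lra.
have p5 : (5 <= p)%N by case: Hpq => // /(_ q2).
have nE : n = 1 by rewrite q2; lra.
have p5' : 5 <= p%:R :> R by rewrite (ler_nat _ 5).
have [|r r0 [rr _]] := derive_gt0_local dP.
  by rewrite /d nE; nra.
exists (1 + r / 2); first by lra.
have -> : 0 = slope_poly p n 1 by rewrite P1 nE; ring.
by apply: rr; lra.
Qed.

(** The three values are [2 (1 - y)], [1 - y ^ 2] and [(1 - y) ^ 3]. *)
Lemma slope_poly_neg y : q = 2%N -> p \in [:: 2; 3; 4]%N -> 1 < y ->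
  slope_poly p n y < 0.
Proof.
move=> q2 pI y1; have nE : n = 1 by rewrite q2; lra.
rewrite /slope_poly nE.
move: pI; rewrite !inE => /or3P[] /eqP ->; rewrite ?expr1 ?expr0; [lra|nra|].
have : 0 < (y - 1) ^+ 3 by rewrite exprn_gt0// subr_gt0.
rewrite -[(4 - 2)%N]/2%N -[(4 - 1)%N]/3%N.
have -> : (y - 1) ^+ 3 = y ^+ 3 - 3 * y ^+ 2 + 3 * y - 1 by ring.
lra.
Qed.

Lemma profile_competition : exists x0,
  [/\ competition alignment alignment1 alignment2 entropy entropy1 entropy2 flat_beta e x0,
      q <> 2%N \/ (5 <= p)%N -> e < x0 &
      q = 2%N -> p \in [:: 2; 3; 4]%N -> x0 = e].
Proof.
have /andP[e0 e2] := e_bounds.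
have [x0 /andP[ex x1] [xmax wl wr]] := weight_peak.
have dw z : z < 1 -> is_derive z 1 weight (weight1 z) by exact: weight_derive.
have flat_beta_lt x y : 0 < x < 1 -> 0 < y < 1 -> weight x < weight y -> flat_beta y < flat_beta x.
  move=> hx hy wxy.
  by rewrite /flat_beta ltf_pV2 ?posrE ?(mulr_gt0 pp_gt0) ?weight_gt0// ltr_pM2l.
exists x0; split.
- apply: Competition => //.
  + exact: alignment_continuous.
  + exact: entropy_continuous.
  + exact: alignment_norm_le1.
  + by move=> x _; exact: alignment_derive.
  + by move=> x _; exact: alignment1_derive.
  + exact: entropy_derive.
  + exact: entropy1_derive.
  + exact: alignment2_gt0.
  + exact: entropy2E.
  + move=> x y ex' xy yx; apply: flat_beta_lt; [lra|lra|].
    apply: (derive_gt0_lt (f1 := weight1) xy) => z zxy; first exact: weight_continuous.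
      by apply: dw; lra.
    by apply: wl; lra.
  + move=> x y ex' xy yx; apply: flat_beta_lt; [lra|lra|].
    apply: (derive_lt0_gt (f1 := weight1) xy) => z zxy; first exact: weight_continuous.
      by apply: dw; lra.
    by apply: wr; lra.
  + apply: cvgV; first by rewrite gt_eqF// mulr_gt0// weight_gt0//; lra.
    by apply: cvgM; [exact: cvg_cst|exact: weight_continuous].
  + exact: alignment1_e.
  + exact: entropy1_e.
  + exact: energy1_near_1.
- move=> /slope_poly_pos[y y1 Py].
  have yn0 : 0 < y + n by rewrite addr_gt0//; lra.
  (* the point at which the ratio [x / other x] is [y] *)
  pose x := y / (y + n).
  have x1' : x < 1 by rewrite ltr_pdivrMr// mul1r ltrDl.
  have oE : other x = (y + n)^-1.
    by rewrite /other /x; field; rewrite n_neq0 gt_eqF.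
  have xE : x / other x = y by rewrite oE invrK divfK// gt_eqF.
  have exx : e < x.
    rewrite /x ltr_pdivlMr// mulrC ltr_pdivrMr ?ltr0n ?(leq_trans _ hq)//.
    have : 0 < n * (y - 1) by rewrite mulr_gt0// subr_gt0.
    lra.
  have wx : 0 < weight1 x.
    by rewrite ltNge; have [-> _] := weight1_sign x1'; rewrite xE -ltNge.
  rewrite lt_neqAle ex andbT; apply/eqP => xE'.
  have : weight1 x < 0 by apply: wr; rewrite -xE' exx.
  by rewrite ltNge ltW.
- move=> q2 pI; apply/eqP; rewrite eq_le ex andbT leNgt; apply/negP => exx.
  pose z := (e + x0) / 2.
  have zx : e < z < x0 by rewrite /z; lra.
  have z1 : z < 1 by lra.
  have : 0 < weight1 z by exact: wl.
  rewrite ltNge ltW//; have [_ ->] := weight1_sign z1.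
  by apply: slope_poly_neg => //; apply: ratio_gt1; lra.
Qed.

Lemma profile_smooth_comp m (U : set R) (w : R -> R) :
  (forall h, U h -> 0 < w h < 1) -> diffn m U w ->
  [/\ diffn m U (alignment \o w), diffn m U (alignment1 \o w),
      diffn m U (alignment2 \o w) & diffn m U (entropy2 \o w)].
Proof.
move=> w01 Cw.
have C1w : diffn m U (fun h => 1 - w h).
  by apply: (diffnB (f := cst 1)) => //; exact: diffn_cst.
have Co : diffn m U (fun h => other (w h)).
  by apply: (diffnM (g := cst n^-1)) => //; exact: diffn_cst.
have CX k := diffnX k Cw; have CO k := diffnX k Co.
split.
- apply: (diffnD (CX p)); apply: (diffnM (f := cst n)) => //; exact: diffn_cst.
- apply: (diffnM (f := cst p%:R)); [exact: diffn_cst|exact: diffnB].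
- apply: (diffnM (f := cst (p%:R * (p%:R - 1)))); first exact: diffn_cst.
  apply: (diffnD (CX _)); apply: (diffnM (g := cst n^-1)) => //; exact: diffn_cst.
- apply: diffnN; apply: diffnD; apply: diffnV => // h /w01 /andP[w0 w1].
    by rewrite gt_eqF.
  by rewrite gt_eqF// subr_gt0.
Qed.

End Profile.

(** * Maximizers on the simplex *)

Section Simplex.
Context {R : realType}.
Variables (p q : nat).
Hypotheses (hp : (2 <= p)%N) (hq : (2 <= q)%N).
Implicit Types (x y z b h : R) (t m : 'rV[R]_q) (i j r : 'I_q).

Local Notation n := (q%:R - 1 : R).
Local Notation e := (q%:R^-1 : R).
Local Notation F := (energy (@alignment R p q) (@entropy R q)).
Local Notation F2 := (energy2 (@alignment2 R p q) (@entropy2 R)).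
Local Notation maximizer_from := (maximizer_from (@alignment R p q) (@entropy R q)).

Local Notation simplex := (@prob_vectors R q).

Let o : 'I_q := Ordinal (ltnW hq).

Let n_ge1 : 1 <= n.
Proof. by rewrite lerBrDr -(natrD _ 1 1) ler_nat. Qed.
Let n_gt0 : 0 < n. Proof. exact: lt_le_trans n_ge1. Qed.
Let pp_gt0 : 0 < p%:R * (p%:R - 1) :> R.
Proof.
have : 2 <= p%:R :> R by rewrite ler_nat.
by move=> ?; rewrite mulr_gt0//; lra.
Qed.
Let pm1E : p%:R - 1 = (p - 1)%:R :> R.
Proof. by rewrite natrB// (leq_trans _ hp). Qed.
Let pE : (p - 1)%N = (p - 2).+1. Proof. by lia. Qed.

(** [H] is a sum of functions of single coordinates, the external field acting on
the coordinate [o]. *)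
Definition site b h r z := b * z ^+ p + h * (r == o)%:R * z - z * ln z.
Definition site1 b h r z := b * (p%:R * z ^+ (p - 1)) + h * (r == o)%:R - (ln z + 1).
Definition site2 b z := b * p%:R * (p%:R - 1) * z ^+ (p - 2) - z^-1.

Lemma H_sites b h t : H p b h t = \sum_r site b h r (t 0 r).
Proof.
rewrite /H /site !big_split /= sumrN mulr_sumr; congr (_ + _ - _).
rewrite /first_coord mulr_sumr big_mkcond /=; apply: eq_bigr => r _.
have -> : (r == 0%N :> nat) = (r == o) by [].
by case: eqP => _; rewrite ?mulr1 ?mulr0 ?mul0r.
Qed.

Lemma site_continuous b h r : continuous (site b h r).
Proof.
move=> z; apply: cvgB; last exact: xlnx_continuous.
apply: cvgD; apply: cvgM; try exact: cvg_cst; last exact: cvg_id.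
exact: is_derive_continuous (is_derive_expr p z).
Qed.

Lemma site_derive b h r z : 0 < z -> is_derive z 1 (site b h r) (site1 b h r z).
Proof.
move=> z0; have dl := is_derive1_ln z0; have dX := is_derive_expr p z.
have -> : site b h r = b \*: (fun y => y ^+ p) + (h * (r == o)%:R) \*: id
   - id * (ln (R := R)) by [].
have zV : z * z^-1 = 1 by rewrite mulfV// gt_eqF.
apply: is_derive_eq; rewrite /GRing.scale /= /site1 subn1 !mulr1 zV.
by congr (_ - _); rewrite addrC.
Qed.

Lemma site1_derive b h r z : 0 < z -> is_derive z 1 (site1 b h r) (site2 b z).
Proof.
move=> z0; have dl := is_derive1_ln z0; have dX := is_derive_expr (p - 1) z.
have -> : site1 b h r = (b * p%:R) \*: (fun y => y ^+ (p - 1))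
    + cst (h * (r == o)%:R) - (ln (R := R) + cst 1).
  by apply/funext => y; rewrite /site1 mulrA.
apply: is_derive_eq; rewrite /GRing.scale /= /site2 pE /= -pE pm1E.
by rewrite !addr0 !mulrA.
Qed.

Lemma site2_lt b y z : 0 < b -> 0 < y -> y < z -> 0 <= site2 b y -> 0 < site2 b z.
Proof.
move=> b0 y0 yz; rewrite /site2 !subr_ge0 subr_gt0 => H.
apply: (@lt_le_trans _ _ y^-1); first by rewrite ltf_pV2 ?posrE// (lt_trans y0).
apply: (le_trans H); rewrite ler_pM2l; last by rewrite -mulrA mulr_gt0.
by rewrite lerXn2r ?nnegrE ?ltW// (lt_trans y0).
Qed.

(** ** The curve of symmetric vectors *)

Definition point i x : 'rV[R]_q := \row_r (if r == i then x else other q x).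

Lemma sum_except (c : R) i : \sum_(r | r != i) c = n * c.
Proof.
have -> : n = q.-1%:R by rewrite -subn1 natrB// ltnW.
by rewrite sumr_const cardC1 card_ord mulr_natl.
Qed.

Lemma point_prob i x : 0 <= x <= 1 -> simplex (point i x).
Proof.
move=> x01; have /andP[b0 _] := other_le1 hq x01; split=> [r|].
  by rewrite mxE; case: eqP => // _; case/andP: x01.
rewrite (bigD1 i)//= mxE eqxx (eq_bigr (fun=> other q x)) => [|r /negbTE ri].
  by rewrite sum_except mul_n_other//; ring.
by rewrite mxE ri.
Qed.

Lemma H_point b h i x : h = 0 \/ i = o -> 0 <= x <= 1 ->
  H p b h (point i x) = F b h x.
Proof.
move=> hi /andP[x0 x1]; rewrite H_sites (bigD1 i)//= mxE eqxx.
rewrite (eq_bigr (fun=> b * other q x ^+ p - other q x * ln (other q x))); last first.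
  move=> r ri; rewrite mxE (negbTE ri) /site.
  case: hi => [->|io]; first by rewrite !mul0r addr0.
  by rewrite -io (negbTE ri) mulr0 mul0r addr0.
rewrite sum_except /site /energy /alignment /entropy.
have -> : h * (i == o)%:R * x = h * x.
  by case: hi => [->|->]; rewrite ?mul0r// eqxx mulr1.
have E : n * (other q x * ln (other q x)) = (1 - x) * ln (1 - x) - (1 - x) * ln n.
  rewrite mulrA mul_n_other//; move: x1; rewrite le_eqVlt => /predU1P[->|x1].
    by rewrite subrr !mul0r subrr.
  by rewrite -mulrBr -ln_div ?posrE// subr_gt0.
by rewrite mulrBr E; ring.
Qed.

(** The parametrization by [s] is an affine change of the first coordinate. *)
Lemma x_vecE s : x_vec q s = point o ((1 + n * s) / q%:R).
Proof.
have q0 : q%:R != 0 :> R by rewrite pnatr_eq0 -lt0n ltnW.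
apply/rowP => r; rewrite !mxE.
have -> : (r == 0%N :> nat) = (r == o) by [].
by case: eqP => // _; rewrite /other; field; rewrite q0 gt_eqF.
Qed.

Lemma maximizer_exists b h :
  exists m, global_maximizers (H p b h) simplex m.
Proof.
have add_cont : continuous (fun x : R * R => x.1 + x.2) by exact: add_continuous.
have cH : continuous (H p b h : 'rV[R]_q -> R).
  have -> : (H p b h : 'rV[R]_q -> R) = fun t => \sum_r site b h r (t 0 r).
    by apply/funext => t; exact: H_sites.
  apply: (continuous_big add_cont) => r _ t.
  apply: (@continuous_comp _ _ _ (fun t : 'rV[R]_q => t 0 r) (site b h r)).
    exact: coord_continuous.
  exact: site_continuous.
have cS : continuous (fun t : 'rV[R]_q => \sum_r t 0 r).
  by apply: (continuous_big add_cont) => r _; exact: coord_continuous.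
have [||t|m mP mmax] := @EVT_max_rV R q (H p b h) simplex.
- by exists (point o 1); apply: point_prob; rewrite ler01 lexx.
- have -> : simplex = [set t : 'rV[R]_q | forall r, `[0, 1]%classic (t ord0 r)]
       `&` (fun t => \sum_r t 0 r) @^-1` [set x : R | x = 1].
    apply/seteqP; split=> [t [t0 t1]|t [t0 t1]]; split=> //.
      move=> r; rewrite /= in_itv /= t0 /= -t1 (bigD1 r)//= lerDl.
      by apply: sumr_ge0.
    by move=> r; have := t0 r; rewrite /= in_itv /= => /andP[].
  apply: compact_closedI.
    by apply: (@rV_compact R _ (fun=> `[(0 : R), 1]%classic)) => _; exact: segment_compact.
  by apply: preimage_closed => //; exact: closed_eq.
- exact: (continuous_subspaceT (A := simplex) cH).
- by exists m; split=> [|t tP]; [exact: set_mem|apply: mmax; exact: mem_set].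
Qed.

(** ** Two coordinates at a time *)

Section Pair.
Variables (b h : R) (m : 'rV[R]_q).
Hypotheses (b0 : 0 < b) (h0 : 0 <= h).
Hypothesis mmax : global_maximizers (H p b h) simplex m.

Let m_ge0 r : 0 <= m 0 r. Proof. by case: mmax => -[]. Qed.

(** Moving mass between two coordinates keeps a vector in the simplex, which
reduces all variations to functions of one variable. *)
Lemma pair_max i j u : i != j -> 0 <= u <= m 0 i + m 0 j ->
  site b h i u + site b h j (m 0 i + m 0 j - u) <=
  site b h i (m 0 i) + site b h j (m 0 j).
Proof.
move=> ij /andP[u0 uc]; case: mmax => -[_ m1] mH.
pose t : 'rV[R]_q := \row_r (if r == i then u else if r == j then m 0 i + m 0 j - u else m 0 r).
have ti : t 0 i = u by rewrite mxE eqxx.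
have tj : t 0 j = m 0 i + m 0 j - u by rewrite mxE eq_sym (negbTE ij) eqxx.
have tr r : (r != i) && (r != j) -> t 0 r = m 0 r.
  by move=> /andP[/negbTE ri /negbTE rj]; rewrite mxE ri rj.
have split_sum (G : 'I_q -> R) :
    \sum_r G r = G i + (G j + \sum_(r | (r != i) && (r != j)) G r).
  by rewrite (bigD1 i)//= (bigD1 j)//= eq_sym.
have : H p b h t <= H p b h m.
  apply: mH; split=> [r|].
    by rewrite mxE; case: ifP => // _; case: ifP => // _; rewrite subr_ge0.
  rewrite split_sum ti tj (eq_bigr _ tr) -m1 [in RHS]split_sum; ring.
rewrite !H_sites !split_sum ti tj.
rewrite (eq_bigr (fun r => site b h r (m 0 r))) => [|r /tr ->//].
by rewrite !addrA lerD2r.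
Qed.

(** The entropy has infinite slope at the boundary of the simplex, so moving a
little mass to a vanishing coordinate increases [H]. *)
Lemma maximizer_coord_gt0 i : 0 < m 0 i.
Proof.
rewrite lt_def m_ge0 andbT; apply/eqP => mi.
have [j mj] : exists j, 0 < m 0 j.
  apply: contrapT => H; case: mmax => -[_ m1] _.
  suff : \sum_r m 0 r = 0 by rewrite m1 => /eqP; rewrite oner_eq0.
  apply: big1 => r _; apply/eqP; rewrite eq_le m_ge0 andbT leNgt.
  by apply/negP => mr; apply: H; exists r.
have ij : i != j by apply: contraTneq mj => <-; rewrite mi ltxx.
pose c := m 0 j; have c1 : c <= 1.
  case: mmax => -[_ <-] _; rewrite (bigD1 j)//= lerDl; exact: sumr_ge0.
pose K := fun u => site b h i u + site b h j (c - u).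
have pos1 : 0 <= b * p%:R by rewrite mulr_ge0// ltW.
(* below [d] the term [- ln z] exceeds all the other terms of the slope *)
pose L := b * p%:R + h - ln (c / 2).
pose d := Num.min (c / 2) (expR (- (L + 1))).
have d2 : d <= c / 2 by rewrite ge_min lexx.
have dE : d <= expR (- (L + 1)) by rewrite ge_min lexx orbT.
have d0 : 0 < d by rewrite lt_min divr_gt0//= expR_gt0.
have cmid z : {for z, continuous (fun u : R => c - u)}.
  by apply: cvgB; [exact: cvg_cst|exact: cvg_id].
have : K 0 < K d.
  apply: (derive_gt0_lt (f1 := fun u => site1 b h i u - site1 b h j (c - u))) => //.
  - move=> z _; apply: cvgD; first exact: site_continuous.
    apply: (@continuous_comp _ _ _ (fun u : R => c - u) (site b h j)) => //.
    exact: site_continuous.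
  - move=> z /andP[z0 zd]; have cz : 0 < c - z by rewrite /c in d2 *; lra.
    have d1 : is_derive z 1 (fun u : R => c - u) (- 1).
      have -> : (fun u : R => c - u) = cst c - id by [].
      by apply: is_derive_eq; rewrite sub0r.
    have D2 := @is_derive1_comp R _ (fun u : R => c - u) z _ _ (site_derive b h j cz) d1.
    have := is_deriveD (site_derive b h i z0) D2.
    by rewrite mulrN1.
  - move=> z /andP[z0 zd].
    have cz : c / 2 <= c - z by rewrite /c in d2 *; lra.
    have lz : ln z < - (L + 1).
      by rewrite -[- (L + 1)]expRK ltr_ln ?posrE ?expR_gt0// (lt_le_trans zd).
    have lc : ln (c / 2) <= ln (c - z).
      by rewrite ler_ln ?posrE ?divr_gt0// (lt_le_trans _ cz)// divr_gt0.
    have P1 : 0 <= b * (p%:R * z ^+ (p - 1)).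
      by rewrite mulr_ge0 ?ltW// mulr_gt0 ?exprn_gt0// ltr0n ltnW.
    have P2 : b * (p%:R * (c - z) ^+ (p - 1)) <= b * p%:R.
      rewrite ler_pM2l// ler_piMr// exprn_ile1//; rewrite /c in c1 d2 mj *; lra.
    have h1 : 0 <= h * (i == o)%:R by rewrite mulr_ge0.
    have h2 : h * (j == o)%:R <= h by case: eqP => _; rewrite ?mulr1 ?mulr0.
    rewrite /site1 /L in lz *; lra.
rewrite ltNge => /negP; apply; rewrite /K.
have := @pair_max i j d ij; rewrite mi add0r subr0 -/c; apply.
by rewrite (ltW d0) (le_trans d2)// /c; lra.
Qed.

Lemma pair_critical i j : i != j ->
  site1 b h i (m 0 i) = site1 b h j (m 0 j) /\
  site2 b (m 0 i) + site2 b (m 0 j) <= 0.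
Proof.
move=> ij; have mi := maximizer_coord_gt0 i; have mj := maximizer_coord_gt0 j.
pose c := m 0 i + m 0 j.
pose K := fun u => site b h i u + site b h j (c - u).
pose K1 := fun u => site1 b h i u - site1 b h j (c - u).
have d1 z : is_derive z 1 (fun u : R => c - u) (- 1).
  have -> : (fun u : R => c - u) = cst c - id by [].
  by apply: is_derive_eq; rewrite sub0r.
have dK z : 0 < z < c -> is_derive z 1 K (K1 z).
  move=> /andP[z0 zc]; have cz : 0 < c - z by rewrite subr_gt0.
  have D2 := @is_derive1_comp R _ (fun u : R => c - u) z _ _ (site_derive b h j cz) (d1 z).
  have := is_deriveD (site_derive b h i z0) D2.
  by rewrite mulrN1.
have cE : c - m 0 i = m 0 j by rewrite /c; ring.
have ic : 0 < m 0 i < c by rewrite mi ltrDl.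
have Kmax z : 0 < z < c -> K z <= K (m 0 i).
  by move=> /andP[z0 zc]; rewrite /K cE; apply: pair_max; rewrite // !ltW.
split.
  have := interior_max_derive ic (dK _ ic) Kmax.
  by rewrite /K1 cE => /eqP; rewrite subr_eq0 => /eqP.
apply: (interior_max_derive2 ic dK _ Kmax).
have cz : 0 < c - m 0 i by rewrite cE.
have D2 := @is_derive1_comp R _ (fun u : R => c - u) _ _ _ (site1_derive b h j cz) (d1 (m 0 i)).
have := is_deriveB (site1_derive b h i mi) D2.
by rewrite mulrN1 opprK cE.
Qed.

(** Below a largest coordinate the others coincide: two different ones would
enclose a zero of [site2], making [site2] positive at the larger of them and
at the largest coordinate, against the second-order condition. *)
Lemma others_equal i : (forall r, m 0 r <= m 0 i) -> h = 0 \/ i = o ->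
  forall r s, r != i -> s != i -> m 0 r = m 0 s.
Proof.
move=> imax hi.
suff main r s : r != i -> s != i -> m 0 s <= m 0 r.
  by move=> r s ri si; apply/eqP; rewrite eq_le !main.
move=> ri si; rewrite leNgt; apply/negP => rs.
have mr := maximizer_coord_gt0 r.
have rsn : r != s by apply: contraTneq rs => ->; rewrite ltxx.
have [E _] := pair_critical rsn.
have {E} E : site1 b 0 o (m 0 r) = site1 b 0 o (m 0 s).
  move: E; rewrite /site1 !mul0r !addr0; case: hi => [->|io]; first by rewrite !mul0r !addr0.
  by rewrite -io (negbTE ri) (negbTE si) mulr0 !addr0.
have [z||z /andP[rz zs] z0] := derive_eq_zero rs E (f1 := site2 b).
- move=> /andP[rz _]; apply: is_derive_continuous (site1_derive _ _ _ _).
  exact: lt_le_trans rz.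
- by move=> z /andP[rz _]; apply: site1_derive; exact: lt_trans rz.
have z_gt0 : 0 < z := lt_trans mr rz.
have s2 : 0 < site2 b (m 0 s) by apply: (site2_lt b0 z_gt0 zs); rewrite z0.
have i2 : 0 < site2 b (m 0 i).
  by apply: (site2_lt b0 z_gt0 (lt_le_trans zs (imax s))); rewrite z0.
have [_] := pair_critical si.
by rewrite leNgt addr_gt0.
Qed.

Lemma field_coord_max : 0 < h -> forall r, m 0 r <= m 0 o.
Proof.
move=> h_gt0 r; have [->//|ro] := eqVneq r o.
have := @pair_max o r (m 0 r); rewrite eq_sym => /(_ ro).
rewrite m_ge0 lerDr m_ge0 => /(_ isT).
rewrite /site eqxx (negbTE ro) !mulr1 !mulr0 !mul0r !addr0 addrK => P.
rewrite -(ler_pM2l h_gt0); lra.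
Qed.

(** The largest coordinate is the first one if there is a field, since swapping
coordinates would otherwise increase [H]; without field any largest
coordinate will do. *)
Lemma maximizer_symmetric : exists i x,
  [/\ h = 0 \/ i = o, e <= x < 1 & m = point i x].
Proof.
have [i [imax hi]] : exists i, (forall r, m 0 r <= m 0 i) /\ (h = 0 \/ i = o).
  move: h0; rewrite le_eqVlt => /predU1P[h0'|h_gt0].
    have [i _ imax] := @arg_maxP _ _ _ o xpredT (fun r => m 0 r) isT.
    by exists i; split; [move=> r; exact: imax|left].
  by exists o; split; [exact: field_coord_max|right].
have [j ji] : exists j, j != i.
  have : (0 < #|predC1 i|)%N by rewrite cardC1 card_ord; lia.
  by move=> /card_gt0P[j]; rewrite !inE => ji; exists j.
have mE r : r != i -> m 0 r = m 0 j by move=> ri; exact: (others_equal imax hi).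
have sE : m 0 i + n * m 0 j = 1.
  by case: mmax => -[_ m1] _; rewrite -[RHS]m1 (bigD1 i)//= (eq_bigr _ mE) sum_except.
have oE : other q (m 0 i) = m 0 j.
  have -> : m 0 i = 1 - n * m 0 j by move: sE; lra.
  by rewrite /other; field; rewrite gt_eqF.
have mj := maximizer_coord_gt0 j.
exists i, (m 0 i); split=> //.
  have q0 : 0 < q%:R :> R by rewrite ltr0n ltnW.
  have : 0 < n * m 0 j by rewrite mulr_gt0.
  have : n * m 0 j <= n * m 0 i by rewrite ler_pM2l.
  have : 1 <= q%:R * m 0 i -> e <= m 0 i by rewrite -ler_pdivrMl ?mulr1.
  move=> H ? ?; apply/andP; split; last by lra.
  apply: H; lra.
apply/rowP => r; rewrite mxE; case: eqP => [->//|/eqP ri].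
by rewrite mE.
Qed.

End Pair.

Section Reduction.
Variables (b h : R).
Hypotheses (b0 : 0 < b) (h0 : 0 <= h).

Let e_ge0 : 0 <= e. Proof. by rewrite invr_ge0. Qed.

Lemma point_maximizer m : global_maximizers (H p b h) simplex m ->
  exists i x, [/\ h = 0 \/ i = o, m = point i x & maximizer_from e b h x].
Proof.
move=> mmax; have [i [x [hi /andP[ex x1] mE]]] := maximizer_symmetric b0 h0 mmax.
exists i, x; split=> //; split; first by rewrite ex ltW.
move=> y /andP[ey y1]; case: mmax => _ mH.
have x01 : 0 <= x <= 1 by rewrite (le_trans e_ge0 ex) ltW.
have y01 : 0 <= y <= 1 by rewrite (le_trans e_ge0 ey).
by rewrite -(H_point b hi x01) -(H_point b hi y01) -mE; apply: mH; exact: point_prob.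
Qed.

(** A maximizer on the simplex exists by compactness and is of the symmetric
form, where the one-variable energy controls it. *)
Lemma maximizer_point x : maximizer_from e b h x ->
  global_maximizers (H p b h) simplex (point o x).
Proof.
move=> [/andP[ex x1] xmax].
have x01 : 0 <= x <= 1 by rewrite (le_trans e_ge0 ex).
split; first exact: point_prob.
have [m mmax] := maximizer_exists b h => t tP.
apply: (@le_trans _ _ (H p b h m)); first exact: mmax.2.
have [i [y [hi -> [ey _]]]] := point_maximizer mmax.
have y01 : 0 <= y <= 1 by case/andP: ey => ey y1; rewrite (le_trans e_ge0 ey).
by rewrite (H_point b hi y01) (H_point b (or_intror erefl) x01); exact: xmax.
Qed.

Lemma f_maximizers s : global_maximizers (f p q b h) `[0, 1]%classic s <->
  0 <= s /\ maximizer_from e b h ((1 + n * s) / q%:R).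
Proof.
have q0 : 0 < q%:R :> R by rewrite ltr0n ltnW.
pose xi z := (1 + n * z) / q%:R.
have xi01 z : (0 <= z <= 1) = (e <= xi z <= 1).
  rewrite /xi ler_pdivlMr// mulVf ?gt_eqF// lerDl pmulr_rge0//.
  by rewrite ler_pdivrMr// mul1r -lerBrDl ger_pMr.
have fE z : 0 <= z <= 1 -> f p q b h z = F b h (xi z).
  rewrite xi01 /f x_vecE -/(xi z) => /andP[ez z1].
  by rewrite H_point//; [right|rewrite (le_trans e_ge0 ez)].
split=> [[]|[s0 [sI smax]]]; rewrite /= ?in_itv /=.
  move=> s01 smax; split; first by case/andP: s01.
  split; first by rewrite -xi01.
  move=> y ey; pose z := (q%:R * y - 1) / n.
  have yE : y = xi z by rewrite /xi /z; field; rewrite !gt_eqF.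
  have z01 : 0 <= z <= 1 by rewrite xi01 -yE.
  rewrite yE -(fE _ z01) -(fE _ s01); apply: smax; by rewrite /= in_itv.
rewrite -xi01 in sI; split=> // y; rewrite /= in_itv /= => y01.
by rewrite (fE _ y01) (fE _ sI); apply: smax; rewrite -xi01.
Qed.

End Reduction.

(** ** The quadratic form *)

Lemma Q_point i x b t : Q p (point i x) b t =
  site2 b x * t 0 i ^+ 2 + site2 b (other q x) * \sum_(r | r != i) t 0 r ^+ 2.
Proof.
rewrite /Q (bigD1 i)//= mxE eqxx; congr (_ + _); rewrite mulr_sumr.
by apply: eq_bigr => r /negbTE ri; rewrite mxE ri.
Qed.

Lemma energy2_sites b x : x < 1 -> F2 b x = site2 b x + site2 b (other q x) / n.
Proof.
move=> x1; rewrite /energy2 /alignment2 /entropy2 /site2.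
have -> : (1 - x)^-1 = (other q x)^-1 / n by rewrite -(mul_n_other hq x) invfM mulrC.
by ring.
Qed.

Lemma Hq_others i t : Hq t -> \sum_(r | r != i) t 0 r = - t 0 i.
Proof. by rewrite /Hq /= (bigD1 i)//= => /eqP; rewrite addrC addr_eq0 => /eqP. Qed.

(** On [Hq] the coordinates other than [i] sum to [- t i], so their squares sum
to at least [t i ^ 2 / (q - 1)] by Cauchy-Schwarz. Their coefficient is negative:
otherwise the coefficient of the larger value [x] would be nonnegative too,
and so would [F2 b x]. The form is then at most [F2 b x * t i ^ 2]. *)
Lemma Q_negative_definite i x b : 0 < b -> e <= x < 1 -> F2 b x < 0 ->
  negative_definite_on_Hq (Q p (point i x) b).
Proof.
move=> b0 /andP[ex x1]; rewrite energy2_sites// => neg t tH t0.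
have q0 : 0 < q%:R :> R by rewrite ltr0n ltnW.
have x0 : 0 < x by apply: lt_le_trans ex; rewrite invr_gt0.
have bx : other q x <= x.
  rewrite ler_pdivrMr//; have : 1 <= q%:R * x by rewrite -ler_pdivrMl ?mulr1.
  lra.
have ob := other_gt0 hq x1.
have c2 : site2 b (other q x) < 0.
  rewrite ltNge; apply/negP => c2.
  have c1 : 0 <= site2 b x.
    by move: bx; rewrite le_eqVlt => /predU1P[<-//|bx]; apply/ltW/(site2_lt b0 ob bx c2).
  have : 0 <= site2 b x + site2 b (other q x) / n.
    by rewrite addr_ge0// divr_ge0// ltW.
  by rewrite leNgt neg.
rewrite Q_point; set T := \sum_(r | _) _.
have CS : t 0 i ^+ 2 / n <= T.
  have : 0 <= \sum_(r | r != i) (t 0 r + t 0 i / n) ^+ 2.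
    by apply: sumr_ge0 => r _; rewrite sqr_ge0.
  under eq_bigr do rewrite sqrrD.
  rewrite !big_split /= -/T sum_except.
  rewrite -mulr_suml (Hq_others i tH).
  have -> : n * (t 0 i / n) ^+ 2 = t 0 i ^+ 2 / n by field; rewrite gt_eqF.
  have -> : - t 0 i * (t 0 i / n) = - (t 0 i ^+ 2 / n) by ring.
  lra.
have [ti|ti] := eqVneq (t 0 i) 0.
  rewrite ti expr0n mulr0 add0r pmulr_llt0//.
  rewrite lt_def sumr_ge0 ?andbT => [|r _]; last exact: sqr_ge0.
  apply/eqP => T0; apply: t0; apply/rowP => r; rewrite mxE.
  have [->//|ri] := eqVneq r i.
  apply/eqP; rewrite -sqrf_eq0; apply/eqP.
  exact: (psumr_eq0P (fun s _ => sqr_ge0 (t 0 s)) T0).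
have t2 : 0 < t 0 i ^+ 2 by rewrite exprn_even_gt0.
apply: (@le_lt_trans _ _ ((site2 b x + site2 b (other q x) / n) * t 0 i ^+ 2)).
  rewrite [leRHS]mulrDl lerD2l -mulrA [n^-1 * _]mulrC.
  by rewrite ler_nM2l.
by rewrite pmulr_llt0.
Qed.

(** The equality case of the Cauchy-Schwarz bound. *)
Lemma Q_singular i x b : x < 1 -> F2 b x = 0 ->
  singular_on_Hq (Q p (point i x) b).
Proof.
move=> x1; rewrite energy2_sites// => Z.
pose t : 'rV[R]_q := \row_r (if r == i then 1 else - n^-1).
have tr r : r != i -> t 0 r = - n^-1 by move=> /negbTE ri; rewrite mxE ri.
have ti : t 0 i = 1 by rewrite mxE eqxx.
have nV : n != 0 by rewrite gt_eqF.
exists t; split.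
- rewrite /Hq /= (bigD1 i)//= ti (eq_bigr _ tr) sum_except mulrN mulfV//.
  by rewrite subrr.
- by move=> /rowP/(_ i); rewrite ti mxE => /eqP; rewrite oner_eq0.
- rewrite Q_point ti (eq_bigr (fun=> (- n^-1) ^+ 2)) => [|r /tr->//].
  rewrite sum_except -[RHS]Z; congr (_ + _); first by rewrite expr1n mulr1.
  by field.
Qed.

End Simplex.

(** * Special and critical points *)

Section Classification.
Context {R : realType}.
Variables (p q : nat).
Hypotheses (hp : (2 <= p)%N) (hq : (2 <= q)%N).
Implicit Types (x y z b h : R).

Local Notation n := (q%:R - 1 : R).
Local Notation e := (q%:R^-1 : R).
Local Notation simplex := (@prob_vectors R q).
Local Notation A := (@alignment R p q).
Local Notation A1 := (@alignment1 R p q).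
Local Notation A2 := (@alignment2 R p q).
Local Notation S := (@entropy R q).
Local Notation S1 := (@entropy1 R q).
Local Notation S2 := (@entropy2 R).
Local Notation rho := (@flat_beta R p q).
Local Notation coexistence := (coexistence A S e).
Local Notation o := (Ordinal (ltnW hq)).

Variable x0 : R.
Hypothesis C : competition A A1 A2 S S1 S2 rho e x0.
Local Notation bt := (rho x0).
Local Notation ht := (h_deg A1 S1 rho x0).

Let q0 : 0 < q%:R :> R. Proof. by rewrite ltr0n ltnW. Qed.
Let n_gt0 : 0 < n. Proof. by rewrite subr_gt0 ltr1n. Qed.

Lemma more_than_one_coexistence b h : 0 < b -> 0 <= h ->
  more_than_one (global_maximizers (f p q b h) `[0, 1]%classic) <-> coexistence b h.
Proof.
move=> b0 h0; split.
  have inj s s' : (1 + n * s) / q%:R = (1 + n * s') / q%:R -> s = s'.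
    move=> E; have : (1 + n * s) = (1 + n * s') by apply: (mulIf _ E); rewrite invr_eq0 gt_eqF.
    by move=> /addrI /mulfI; apply; rewrite gt_eqF.
  move=> [s [s' [/(f_maximizers p hq) [_ sm] /(f_maximizers p hq) [_ sm'] ss]]].
  case: (ltgtP ((1 + n * s) / q%:R) ((1 + n * s') / q%:R)) => E.
  - by exists ((1 + n * s) / q%:R), ((1 + n * s') / q%:R).
  - by exists ((1 + n * s') / q%:R), ((1 + n * s) / q%:R).
  - by case: ss; exact: inj.
have lift z : maximizer_from A S e b h z ->
    global_maximizers (f p q b h) `[0, 1]%classic ((q%:R * z - 1) / n).
  move=> zm; apply/(f_maximizers p hq); split.
    case: zm => /andP[ez _] _; rewrite divr_ge0 ?(ltW n_gt0)// subr_ge0.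
    by rewrite -ler_pdivrMl// mulr1.
  have -> : (1 + n * ((q%:R * z - 1) / n)) / q%:R = z; last by [].
  by field; rewrite !gt_eqF.
move=> [u [v [uv um vm]]]; exists ((q%:R * u - 1) / n), ((q%:R * v - 1) / n).
split; [exact: lift|exact: lift|] => E.
move: uv; rewrite -(ltr_pM2l q0) -(ltrD2r (-1)).
by rewrite -(ltr_pM2r (x := n^-1)) ?invr_gt0// E ltxx.
Qed.

(** Coexisting maximizers lie strictly on either side of [x0], where maximizers
are nondegenerate; nondegeneracy is thus automatic. *)
Lemma critical_coexistence b h : 0 < b -> 0 <= h -> coexistence b h ->
  critical p q (b, h).
Proof.
move=> b0 h0 [u [v [uv um vm]]]; have [ux xv bb] := two_maximizers C h0 uv um vm.
split=> //=.
- exists (point o u), (point o v); split; try exact: maximizer_point.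
  by move=> /rowP/(_ o); rewrite !mxE eqxx => E; move: uv; rewrite E ltxx.
- move=> m /(point_maximizer hp hq b0 h0) [i [x [_ -> xm]]].
  have e0 := e_gt0 C; have e1 := le_lt_trans (e_le_x0 C) (x0_lt1 C).
  have x1 := maximizer_lt1 C e0 e1 xm; case: (xm) => /andP[ex _] _.
  have xE : x != x0.
    apply/eqP => xE; have ex0 : e < x.
      by rewrite xE; apply: le_lt_trans ux; case: um => /andP[].
    have [_] := maximizer_critical C e0 ex0 xm.
    by rewrite xE leNgt bb.
  apply: Q_negative_definite => //; first by rewrite ex.
  rewrite (energy2_lt0 C) ?x1 ?andbT; last exact: lt_le_trans ex.
  exact: (maximizer_nondegenerate C h0 xm).
Qed.

Lemma C1_coexistence b h :
  C1 p q (b, h) <-> [/\ 0 < b, 0 <= h & coexistence b h].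
Proof.
split=> [[[[/= b0 h0] _ _]] |[b0 h0 co]].
  by move=> /(more_than_one_coexistence b0 h0).
split; first exact: critical_coexistence.
exact/more_than_one_coexistence.
Qed.

(** For a maximizer of the symmetric form, singularity of [Q] on [Hq] is the
vanishing of the second derivative of the one-variable energy. *)
Lemma special_unique : e < x0 -> 0 < bt ->
  [set x : R * R | special p q x] = [set (bt, ht)].
Proof.
move=> ex bt0; have ht0 := h_deg_gt0 C ex.
have e0 := e_gt0 C; have x01 := x0_lt1 C.
apply/seteqP; split=> [[b h] [[/= b0 h0] [m mE] sing]|_ ->].
  have mm : global_maximizers (H p b h) simplex m by rewrite mE.
  have [i [x [_ mP xm]]] := point_maximizer hp hq b0 h0 mm.
  have x1 := maximizer_lt1 C e0 (lt_trans ex x01) xm; case: (xm) => /andP[ex' _] _.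
  have x0' : 0 < x < 1 by rewrite x1 (lt_le_trans e0).
  have [|_ -> -> //] := degenerate_maximizer_unique C h0 xm.
  apply/eqP; rewrite eq_le; apply/andP; split; rewrite leNgt; apply/negP.
    rewrite (energy2_gt0 C)// => rb; have [xE|xE] := eqVneq x x0.
      have [|_] := maximizer_critical C e0 _ xm; first by rewrite xE.
      by rewrite leNgt rb.
    by have := maximizer_nondegenerate C h0 xm xE; rewrite ltNge ltW.
  move=> neg; have [t [tH t0 Qt]] := sing _ mm.
  have xx : e <= x < 1 by rewrite ex'.
  have := Q_negative_definite hp hq i b0 xx neg tH t0.
  by rewrite -mP Qt ltxx.
have gm : global_maximizers (H p bt ht) simplex (point o x0).
  apply: maximizer_point => //; [exact: ltW|exact: (deg_maximizer C)].
have uniq m : global_maximizers (H p bt ht) simplex m -> m = point o x0.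
  move=> mm; have [i [x [hi -> [xI xmax]]]] := point_maximizer hp hq bt0 (ltW ht0) mm.
  case: hi => [hE|->]; first by move: ht0; rewrite hE ltxx.
  have [->//|xx] := eqVneq x x0.
  have := deg_strict_maximizer C xI xx.
  by rewrite ltNge xmax// !ltW.
split=> //=.
- by split=> //; exact: ltW.
- by exists (point o x0); apply/seteqP; split=> [m /uniq|_ ->].
- move=> m /uniq ->; apply: Q_singular => //.
  by rewrite (energy2E C) ?subrr ?mulr0// x01 (lt_trans e0).
Qed.

(** The infimum is attained, at the transition of the zero-field model. *)
Lemma beta_c_coexistence b : 0 < b -> coexistence b 0 -> beta_c p q = b.
Proof.
move=> b0 co; rewrite /beta_c; set B := [set _ | _].
have lbB : lbound B b.
  move=> b' [_ [s [s0 /(f_maximizers p hq) [_ sm]]]].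
  apply: (coexistence_threshold C co sm).
  by rewrite ltr_pdivlMr// mulVf ?gt_eqF// ltrDl mulr_gt0.
have Bb : B b.
  split; first exact: ltW.
  have /(more_than_one_coexistence b0 (lexx _)) [s [s' [sm sm' ss]]] := co.
  have [/f_maximizers[//|s0 _] /f_maximizers[//|s0' _]] := (sm, sm').
  case: (ltgtP s s') => E; [exists s'|exists s|by case: ss]; split=> //.
    exact: le_lt_trans E.
  exact: le_lt_trans E.
apply/eqP; rewrite eq_le lb_le_inf ?andbT//; last by exists b.
by apply: ge_inf => //; exists b.
Qed.

End Classification.

Unset Implicit Arguments.

Theorem lemmaF11 (R : realType) (p q : nat) (hp : (2 <= p)%N) (hq : (2 <= q)%N) :
  (q <> 2%N \/ (5 <= p)%N ->
    exists bt ht : R,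
      [/\ [set x : R * R | special p q x] = [set (bt, ht)],
          0 < ht &
          exists phi : R -> R,
            [/\ (forall h, 0 <= h < ht -> 0 <= phi h),
                (forall h1 h2, 0 <= h1 -> h1 < h2 -> h2 < ht -> phi h2 < phi h1),
                smooth_on `[0, ht[%classic phi,
                C1 p q = [set (phi h, h) | h in `[0, ht[] &
                phi 0 = beta_c p q /\ phi x @[x --> ht^'-] --> bt]])
  /\
  (q = 2%N /\ p \in [:: 2; 3; 4]%N -> C1 p q = set0 :> set (R * R)).
Proof.
have [x0 [C strict flat]] := @profile_competition R p q hp hq.
have e0 := e_gt0 C; have ex0 := e_le_x0 C; have x01 := x0_lt1 C.
split=> [/strict ex|[q2 pI]]; last first.
  apply/seteqP; split=> [[b h] /(C1_coexistence hp hq C) [_ h0]|//].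
  move=> [u [v [uv um vm]]]; have [ux _ _] := two_maximizers C h0 uv um vm.
  by move: ux; rewrite (flat q2 pI) ltNge; case: um => /andP[->].
have bt0 : 0 < flat_beta p q x0.
  have w0 : 0 < weight p q x0 by apply: weight_gt0; rewrite // x01 andbT (lt_trans e0).
  have p2 : 2 <= p%:R :> R by rewrite ler_nat.
  by rewrite invr_gt0 mulr_gt0// mulr_gt0; lra.
have ht0 := h_deg_gt0 C ex.
have smooth := @profile_smooth_comp R p q.
have [eps eps0 [g gs gP]] := coexistence_curve C ex smooth.
have bt_lt h : 0 <= h < h_deg (alignment1 p q) (entropy1 q) (flat_beta p q) x0 ->
    flat_beta p q x0 < g h.
  move=> hI; have [u [v [uv um vm]]] := gP h hI.
  by have [_ _ ] := two_maximizers C (andP hI).1 uv um vm.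
exists (flat_beta p q x0), (h_deg (alignment1 p q) (entropy1 q) (flat_beta p q) x0).
split=> //; first exact: (special_unique hp hq C).
exists g; split.
- by move=> h /bt_lt /(lt_trans bt0) /ltW.
- move=> h1 h2 h10 h12 h2t.
  by apply: (coexistence_decr C h10 h12); apply: gP; lra.
- pose U := [set h | - eps < h < h_deg (alignment1 p q) (entropy1 q) (flat_beta p q) x0].
  have oU : open U.
    have -> : U = [set h | - eps < h] `&`
        [set h | h < h_deg (alignment1 p q) (entropy1 q) (flat_beta p q) x0].
      by apply/seteqP; split=> h /=; [move=> /andP[]|move=> [l r]; apply/andP].
    by apply: openI; [exact: open_gt|exact: open_lt].
  exists U, g; split=> //; last exact: diffn_derive1n.
  by move=> h /=; rewrite in_itv /= /U /= => /andP[h0 ->]; rewrite andbT; lra.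
- apply/seteqP; split=> [[b h] /(C1_coexistence hp hq C) [b0 h0 co]|_ [h hI <-]].
    have hh := coexistence_h_lt C h0 co.
    exists h; first by rewrite /= in_itv /= h0.
    congr (_, _); apply: (coexistence_inj C h0) co.
    by apply: gP; rewrite h0.
  move: hI; rewrite /= in_itv /= => hI; apply/(C1_coexistence hp hq C); split.
  + exact: lt_trans bt0 (bt_lt _ hI).
  + by case/andP: hI.
  + exact: gP.
- split; last exact: (coexistence_curve_limit C ex gP).
  have g0 : 0 <= (0 : R) < h_deg (alignment1 p q) (entropy1 q) (flat_beta p q) x0.
    by rewrite lexx.
  rewrite (beta_c_coexistence hq C (lt_trans bt0 (bt_lt _ g0)))//.
  exact: gP.
Qed.
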